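(* Let $M$ be a complete $n$-dimensional smooth orientable Riemannian manifold that is locally Euclidean. Assume that $G=(V,E)$ is a graph-directed iterated function system (GIFS) of contractive similitudes defined on $M$ satisfying the graph finite type condition (GFTC), and let $K$ be the associated graph self-similar set. Let $\lambda_\alpha$ be the spectral radius of the associated weighted incidence matrix $A_\alpha$. Then $\dim_{\rm H}(K)=\alpha$, where $\alpha$ is the unique number such that $\lambda_\alpha=1$.
   Context: $M$ is locally Euclidean if every point has a neighborhood isometric to an open subset of a Euclidean space. GIFS. $G=(V,E)$ is a finite directed multigraph with $V=\{1,\dots,t\}$; $E^{i,j}$ is the set of edges from $i$ to $j$, and it is assumed that there is at least one edge in $E^{i,j}$ for all $i,j\in V$. A directed path is a finite string $\mathbf e=e_1\cdots e_p$ of edges such that the terminal vertex of each $e_i$ is the initial vertex of $e_{i+1}$; $|\mathbf e|=p$. $E_p^{i,j}$ is the set of directed paths of length $p$ from $i$ to $j$, $E_p=\bigcup_{i,j=1}^tE_p^{i,j}$, and $E^*=\bigcup_{p\ge1}E_p$; empty paths (length $0$) are also allowed below as edge labels and in compositions. To each $e\in E$ corresponds a contractive similitude $S_e$ on $M$ with ratio $\rho_e\in(0,1)$: $d(S_e(x),S_e(y))=\rho_e d(x,y)$ for the Riemannian distance $d$. Put $S_{\mathbf e}=S_{e_1}\circ\cdots\circ S_{e_p}$, $\rho_{\mathbf e}=\rho_{e_1}\cdots\rho_{e_p}$ (identity and $1$ for empty paths). There is a unique family of nonempty compact sets $K_1,\dots,K_t$ with $K_i=\bigcup_{j=1}^t\bigcup_{e\in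 E^{i,j}}S_e(K_j)$; the graph self-similar set is $K=\bigcup_{i=1}^tK_i$. Nested index sets. Write $\mathbf u\preceq\mathbf v$ if the path $\mathbf u$ is an initial segment of $\mathbf v$ or $\mathbf u=\mathbf v$. A sequence $\{\mathcal F_k\}_{k\ge1}$ of finite subsets of $E^*$, with $\underline m_k=\min_{\mathbf u\in\mathcal F_k}|\mathbf u|$, $\overline m_k=\max_{\mathbf u\in\mathcal F_k}|\mathbf u|$, is a sequence of nested index sets if: (a) $\{\underline m_k\}$, $\{\overline m_k\}$ are nondecreasing and tend to $\infty$; (b) no two distinct elements of $\mathcal F_k$ are comparable under $\preceq$; (c) for $\mathbf v\in E^*$ with $|\mathbf v|>\overline m_k$ there is $\mathbf u\in\mathcal F_k$ with $\mathbf u\preceq\mathbf v$; (d) for $\mathbf v\in E^*$ with $|\mathbf v|<\underline m_k$ there is $\mathbf u\in\mathcal F_k$ with $\mathbf v\preceq\mathbf u$; (e) there is a positive integer $L$, independent of $k$, with $|\mathbf v|-|\mathbf u|\le L$ whenever $\mathbf u\in\mathcal F_k$, $\mathbf v\in\mathcal F_{k+1}$, $\mathbf u\preceq\mathbf v$. Put $\mathcal F_0=\{1,\dots,t\}$ (vertices viewed as empty paths), and call $\{\mathcal F_k\}_{k\ge0}$ a sequence of nested index sets too. Let $\mathcal F_k^{i,j}$ be the set of paths in $\mathcal F_k$ from $i$ to $j$. Vertices. $\mathbb V_k=\{(S_{\mathbf e},i,j,k):\mathbf e\in\mathcal F_k^{i,j},1\le i,j\le t\}$ for $k\ge1$, also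 abbreviated $(S_{\mathbf e},k)$; $\mathbb V_0=\{\omega^1_{\rm root},\dots,\omega^t_{\rm root}\}$, $\omega^i_{\rm root}=(\mathrm{id},i,i,0)$; $\mathbb V=\bigcup_{k\ge0}\mathbb V_k$. For $\omega=(S_{\mathbf e},i,j,k)$ put $S_\omega=S_{\mathbf e}$. Let $\pi(\mathbf e)=(S_{\mathbf e},i,j,k)$ for $\mathbf e\in\mathcal F_k^{i,j}$ viewed at level $k\ge1$, and $\pi(i)=\omega^i_{\rm root}$ for $i\in\mathcal F_0$. Neighbors. A family $\mathbf\Omega=\{\Omega_i\}_{i=1}^t$ of nonempty bounded open subsets of $M$ is invariant if $\bigcup_{e\in E^{i,j}}S_e(\Omega_j)\subset\Omega_i$ for all $i,j$. Vertices $\omega=(S_{\mathbf e},i,j,k)$ and $\omega'=(S_{\mathbf e'},i',j',k)$ of the same level are neighbors if $i=i'$ and $S_{\mathbf e}(\Omega_j)\cap S_{\mathbf e'}(\Omega_{j'})\ne\emptyset$. $\mathcal N(\omega)$ is the set of neighbors of $\omega$ (including $\omega$). Equivalence. Let $\omega=(S_{\mathbf e_\omega},i_\omega,j_\omega,k)$, $\omega'=(S_{\mathbf e_{\omega'}},i_{\omega'},j_{\omega'},k')$. Say $\omega\sim\omega'$ if $\tau=S_{\omega'}S_\omega^{-1}:\bigcup_{\sigma\in\mathcal N(\omega)}S_\sigma(\Omega_{j_\sigma})\to\bigcup_{i=1}^t\Omega_i$ (required to be well defined on this union) induces a bijection $f_\tau:\mathcal N(\omega)\to\mathcal N(\omega')$,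 $f_\tau(S_{\mathbf e_\sigma},i_\omega,j_\sigma,k)=(\tau\circ S_{\mathbf e_\sigma},i_{\omega'},j_{\sigma'},k')$, where $\sigma'=f_\tau(\sigma)$ has third coordinate $j_{\sigma'}$, such that (a) $\#\mathcal N(\omega)=\#\mathcal N(\omega')$ and $j_\sigma=j_{\sigma'}$ for all $\sigma$; and (b) whenever $f_\tau(\sigma)=\sigma'$ and $k_0\ge1$, a directed path $\mathbf e$ satisfies $(S_\sigma\circ S_{\mathbf e},k+k_0)\in\mathbb V_{k+k_0}$ if and only if $(S_{\sigma'}\circ S_{\mathbf e},k'+k_0)\in\mathbb V_{k'+k_0}$. This is an equivalence relation; $[\omega]$ is the neighborhood type of $\omega$. $G$ satisfies (GFTC) if for some invariant family $\mathbf\Omega$ and some sequence of nested index sets $\{\mathcal F_k\}_{k\ge0}$ the quotient $\mathbb V/_\sim$ is finite; fix such a choice. Reduced graph. Put a directed edge labelled by a directed path $\mathbf k$ from $\omega\in\mathbb V_k$ to $\omega'\in\mathbb V_{k+1}$ if there are $\mathbf e\in\mathcal F_k$, $\mathbf e'\in\mathcal F_{k+1}$ with $\pi(\mathbf e)=\omega$, $\pi(\mathbf e')=\omega'$, $\mathbf e'=\mathbf e\mathbf k$; $\omega'$ is then an offspring of $\omega$. First remove, for each vertex, all but the smallest (in lexicographic order, for a fixed order of $E$) of the directed edges going to it; then remove all vertices having no offspring, together with all vertices and edges leading only to them. The result is the reduced graph $\mathbb G_R=(\mathbb V_R,\mathbb E_R)$. Weighted incidence matrix. Let $\mathcal T_1,\dots,\mathcal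 T_q$ be the distinct neighborhood types (of vertices of $\mathbb V_R$). For each $i$ choose $\omega\in\mathbb V_R$ with $[\omega]=\mathcal T_i$, let $\sigma_1,\dots,\sigma_m$ be its offspring in $\mathbb G_R$ and $\mathbf k_\ell$ the label of the unique edge in $\mathbb G_R$ from $\omega$ to $\sigma_\ell$. Then $A_\alpha=(A_\alpha(i,j))_{i,j=1}^q$ with $A_\alpha(i,j)=\sum\{\rho_{\mathbf k_\ell}^\alpha:1\le\ell\le m,\ [\sigma_\ell]=\mathcal T_j\}$, which does not depend on the choice of $\omega$.
   Formalization: Nested index sets are also required to refine: each path in F_{k+1} has an initial segment in F_k (k≥1), without which the reduced graph can be empty; independence of A_α from the chosen ω is a hypothesis, as it can fail; and n≥1. *)

(* Defs.v *)
From HB Require Import structures.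
From mathcomp Require Import all_boot all_order all_algebra finmap.
From mathcomp Require Import all_classical all_reals all_analysis.
From mathcomp Require Import complex.

Set Implicit Arguments.
Unset Strict Implicit.
Unset Printing Implicit Defensive.

Import Order.TTheory GRing.Theory Num.Theory.
Import numFieldNormedType.Exports.

Local Open Scope classical_set_scope.
Local Open Scope ring_scope.

(* All iterated directional derivatives are Frechet differentiable at every
   point of the open set U; this is C^infinity on U. *)
Definition smooth_on (R : realType) (n : nat) (W : normedModType R)
    (U : set 'rV[R]_n) (f : 'rV[R]_n -> W) : Prop :=
  forall (s : seq 'rV[R]_n) (x : 'rV[R]_n), U x ->
    differentiable (foldr (fun v (h : 'rV[R]_n -> W) => fun y => 'D_v h y) f s) x.

Record chart (T : Type) (R : realType) (n : nat) := Chart {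
  chart_dom : set T ;
  chart_fun : T -> 'rV[R]_n ;
  chart_inv : 'rV[R]_n -> T }.

Definition chart_img (T : Type) (R : realType) (n : nat) (c : chart T R n) :
    set 'rV[R]_n := chart_fun c @` chart_dom c.

Definition is_chart (R : realType) (M : metricType R) (n : nat)
    (c : chart M R n) : Prop :=
  [/\ open (chart_dom c), open (chart_img c),
      forall x, chart_dom c x -> chart_inv c (chart_fun c x) = x,
      {within chart_dom c, continuous (chart_fun c)} &
      {within chart_img c, continuous (chart_inv c)}].

Definition transition (T : Type) (R : realType) (n : nat) (c c' : chart T R n) :
    'rV[R]_n -> 'rV[R]_n := fun z => chart_fun c' (chart_inv c z).

Definition overlap (T : Type) (R : realType) (n : nat) (c c' : chart T R n) :
    set 'rV[R]_n := chart_fun c @` (chart_dom c `&` chart_dom c').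

Definition is_atlas (R : realType) (M : metricType R) (n : nat)
    (atlas : set (chart M R n)) : Prop :=
  [/\ forall c, atlas c -> is_chart c,
      forall x, exists2 c, atlas c & chart_dom c x &
      forall c c', atlas c -> atlas c' ->
        smooth_on (overlap c c') (transition c c')].

(* g c z is the Gram matrix of the metric tensor in the chart c at the point
   of coordinates z. Differentials act on row vectors on the right. *)
Definition is_metric_tensor (R : realType) (M : metricType R) (n : nat)
    (atlas : set (chart M R n)) (g : chart M R n -> 'rV[R]_n -> 'M[R]_n) : Prop :=
  (forall c, atlas c ->
     [/\ forall i j : 'I_n, smooth_on (chart_img c) (fun z => g c z i j : R^o),
         forall z, chart_img c z -> (g c z)^T = g c z &
         forall z (v : 'rV[R]_n), chart_img c z -> v != 0 ->
           0 < (v *m g c z *m v^T) 0 0]) /\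
  (forall c c' z, atlas c -> atlas c' -> overlap c c' z ->
     let J := jacobian (transition c c') z in
     g c z = J *m g c' (transition c c' z) *m J^T).

(* A C^1 curve inside one chart, given by its coordinates u on [0, 1]. *)
Definition chart_curve (R : realType) (M : metricType R) (n : nat)
    (g : chart M R n -> 'rV[R]_n -> 'M[R]_n) (c : chart M R n)
    (x y : M) (l : R) : Prop :=
  exists u : R -> 'rV[R]_n,
    [/\ (forall s, derivable u s 1) /\ continuous (fun s => 'D_1 u s),
        forall s, 0 <= s <= 1 -> chart_img c (u s),
        chart_inv c (u 0) = x /\ chart_inv c (u 1) = y &
        l = Rintegral lebesgue_measure `[0, 1]
              (fun s => Num.sqrt (('D_1 u s *m g c (u s) *m ('D_1 u s)^T) 0 0))].

(* Piecewise C^1 curves from x to y of length l, subdivided so that each piece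
   lies in one chart. *)
Inductive curve_length (R : realType) (M : metricType R) (n : nat)
    (atlas : set (chart M R n)) (g : chart M R n -> 'rV[R]_n -> 'M[R]_n) :
    M -> M -> R -> Prop :=
| CurveNil x : curve_length atlas g x x 0
| CurveCons c x y z l l' : atlas c -> chart_curve g c x y l ->
    curve_length atlas g y z l' -> curve_length atlas g x z (l + l').

(* The distance of M is the Riemannian distance. As it is finite, M is
   (path-)connected; the manifold topology is the one of the metric space M. *)
Definition riemannian_manifold (R : realType) (M : metricType R) (n : nat)
    (atlas : set (chart M R n)) (g : chart M R n -> 'rV[R]_n -> 'M[R]_n) : Prop :=
  [/\ @second_countable M, is_atlas atlas, is_metric_tensor atlas g &
      forall x y : M, (mdist x y)%:E =
        ereal_inf [set l%:E | l in [set l | curve_length atlas g x y l]]].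

Definition orientable (R : realType) (M : metricType R) (n : nat)
    (atlas : set (chart M R n)) : Prop :=
  exists atlas' : set (chart M R n),
    [/\ is_atlas atlas',
        forall c c', atlas c -> atlas' c' ->
          smooth_on (overlap c c') (transition c c') /\
          smooth_on (overlap c' c) (transition c' c) &
        forall c c' z, atlas' c -> atlas' c' -> overlap c c' z ->
          0 < \det (jacobian (transition c c') z)].

Definition complete_metric (R : realType) (M : metricType R) : Prop :=
  forall F : set_system M, ProperFilter F -> cauchy F -> exists x : M, F --> x.

(* `|v| on 'rV[R]_m is the sup norm in the library. *)
Definition euclidean_dist (R : realType) (m : nat) (v w : 'rV[R]_m) : R :=
  Num.sqrt (\sum_(i < m) (v 0 i - w 0 i) ^+ 2).

Definition locally_euclidean (R : realType) (M : metricType R) : Prop :=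
  forall x : M, exists (m : nat) (U : set M) (f : M -> 'rV[R]_m),
    [/\ open U, U x, open (f @` U) &
        forall y z, U y -> U z -> euclidean_dist (f y) (f z) = mdist y z].

Definition diam (R : realType) (M : metricType R) (A : set M) : \bar R :=
  ereal_sup [set (mdist p.1 p.2)%:E | p in A `*` A].

(* diam(A)^s, where 0^0 = 1 for nonempty A and the empty set contributes 0. *)
Definition diam_pow (R : realType) (M : metricType R) (s : R) (A : set M) :
    \bar R :=
  if A == set0 then 0%E else (diam A `^ s)%E.

Definition hausdorff_content (R : realType) (M : metricType R) (s delta : R)
    (A : set M) : \bar R :=
  ereal_inf [set (\sum_(0 <= i <oo) diam_pow s (U i))%E | U in
    [set U : nat -> set M |
      (forall i, (diam (U i) <= delta%:E)%E) /\ A `<=` \bigcup_i U i]].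

Definition hausdorff_measure (R : realType) (M : metricType R) (s : R)
    (A : set M) : \bar R :=
  ereal_sup [set hausdorff_content s delta A | delta in [set delta | 0 < delta]].

Definition hausdorff_dim (R : realType) (M : metricType R) (A : set M) : \bar R :=
  ereal_inf [set s%:E | s in
    [set s : R | 0 <= s /\ hausdorff_measure s A = 0%E]].

Definition spectral_radius (R : realType) (q : nat) (A : 'M[R]_q) : R :=
  sup [set Normc.normc z | z in
    [set z : R[i] | eigenvalue (map_mx (real_complex R) A) z]].

(* The order on gedge is the one used to compare edge labels
   lexicographically. *)
Record gifs (R : realType) (M : metricType R) (d : Order.disp_t) := Gifs {
  nvert : nat ;
  gedge : finOrderType d ;
  src : gedge -> 'I_nvert ;
  tgt : gedge -> 'I_nvert ;
  smap : gedge -> M -> M ;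
  ratio : gedge -> R ;
  nvert_gt0 : (0 < nvert)%N ;
  gedge_exists : forall i j : 'I_nvert, exists e, src e = i /\ tgt e = j ;
  ratio_bounds : forall e, 0 < ratio e < 1 ;
  smap_similitude : forall e x y,
    mdist (smap e x) (smap e y) = ratio e * mdist x y }.

Section GraphDirected.
Context {R : realType} {M : metricType R} {d : Order.disp_t}.
Variable G : gifs M d.

Local Notation V := 'I_(nvert G).
Local Notation E := (gedge G).

Definition self_similar_family (K : V -> set M) : Prop :=
  (forall i, K i !=set0 /\ compact (K i)) /\
  (forall i, K i = \bigcup_(e in [set e : E | src e = i]) (smap e @` K (tgt e))).

Fixpoint walk (i : V) (p : seq E) : bool :=
  if p is e :: p' then (src e == i) && walk (tgt e) p' else true.

Definition path_map (p : seq E) : M -> M := foldr (fun e h => smap e \o h) id p.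

Definition path_ratio (p : seq E) : R := \prod_(e <- p) ratio e.

(* A directed path is encoded by its initial vertex and its list of edges, so
   that (i, [::]) is the vertex i viewed as an empty path. *)
Definition dpath : Type := (V * seq E)%type.

Definition is_dpath (u : dpath) : bool := walk u.1 u.2.
Definition dterm (u : dpath) : V := last u.1 (map (@tgt _ _ _ G) u.2).
Definition dlen (u : dpath) : nat := size u.2.
Definition dprefix (u v : dpath) : bool := (u.1 == v.1) && prefix u.2 v.2.
Definition Estar (u : dpath) : Prop := is_dpath u /\ (0 < dlen u)%N.

Definition maxlen (A : {fset dpath}) : nat := \max_(u <- A) dlen u.
(* maxlen A is a neutral element for the lengths of the elements of A *)
Definition minlen (A : {fset dpath}) : nat :=
  \big[minn/maxlen A]_(u <- A) dlen u.

Record nested_index_sets (F : nat -> {fset dpath}) : Prop := NestedIndexSets {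
  nis_zero : forall u, (u \in F 0%N) = (u.2 == [::]) ;
  nis_Estar : forall k u, (0 < k)%N -> u \in F k -> Estar u ;
  nis_min_mono : forall k, (0 < k)%N -> (minlen (F k) <= minlen (F k.+1))%N ;
  nis_max_mono : forall k, (0 < k)%N -> (maxlen (F k) <= maxlen (F k.+1))%N ;
  nis_min_cvg : minlen (F k) @[k --> \oo] --> \oo ;
  nis_max_cvg : maxlen (F k) @[k --> \oo] --> \oo ;
  nis_antichain : forall k u v, (0 < k)%N -> u \in F k -> v \in F k ->
    dprefix u v -> u = v ;
  nis_long : forall k v, (0 < k)%N -> Estar v -> (maxlen (F k) < dlen v)%N ->
    exists2 u, u \in F k & dprefix u v ;
  nis_short : forall k v, (0 < k)%N -> Estar v -> (dlen v < minlen (F k))%N ->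
    exists2 u, u \in F k & dprefix v u ;
  nis_step : exists2 L, (0 < L)%N & forall k u v, (0 < k)%N ->
    u \in F k -> v \in F k.+1 -> dprefix u v -> (dlen v - dlen u <= L)%N ;
  (* F_(k+1) refines F_k. The other conditions do not imply it: they allow a
     path of F_(k+1) to be a strict prefix of one of F_k, hence to have no
     parent, and then the reduced graph may even be empty. *)
  nis_refine : forall k v, (0 < k)%N -> v \in F k.+1 ->
    exists2 u, u \in F k & dprefix u v }.

Record vertex : Type := Vertex {
  vmap : M -> M ; vini : V ; vter : V ; vlev : nat }.

Definition vertex_of (k : nat) (u : dpath) : vertex :=
  Vertex (path_map u.2) u.1 (dterm u) k.

Definition invariant_family (Omega : V -> set M) : Prop :=
  (forall i, [/\ Omega i !=set0, open (Omega i) &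
     exists C : R, forall x y, Omega i x -> Omega i y -> mdist x y <= C]) /\
  (forall e : E, smap e @` Omega (tgt e) `<=` Omega (src e)).

Section Types.
Variables (Omega : V -> set M) (F : nat -> {fset dpath}).

Definition is_vertex (w : vertex) : Prop :=
  exists2 u, u \in F (vlev w) & w = vertex_of (vlev w) u.

Definition vimage (w : vertex) : set M := vmap w @` Omega (vter w).

Definition neighbors (w : vertex) : set vertex :=
  [set s | [/\ is_vertex s, vlev s = vlev w, vini s = vini w &
               vimage w `&` vimage s !=set0]].

(* (S_s o S_p, k + k0) for a vertex s of level k and a path p starting at the
   terminal vertex of s *)
Definition extend (s : vertex) (p : seq E) (k0 : nat) : vertex :=
  Vertex (vmap s \o path_map p) (vini s) (dterm (vter s, p)) (vlev s + k0).

(* tau \o vmap w = vmap w' says that tau = S_w' S_w^-1 on the range of S_w. *)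
Definition vertex_equiv (w w' : vertex) : Prop :=
  exists (tau : M -> M) (f : vertex -> vertex),
    let U := \bigcup_(s in neighbors w) vimage s in
    [/\ [/\ tau \o vmap w = vmap w', U `<=` range (vmap w) &
            tau @` U `<=` \bigcup_i Omega i],
        set_bij (neighbors w) (neighbors w') f /\
        (forall s, neighbors w s ->
           f s = Vertex (tau \o vmap s) (vini w') (vter (f s)) (vlev w')),
        (neighbors w #= neighbors w')%card /\
        (forall s, neighbors w s -> vter s = vter (f s)) &
        forall s k0 p, neighbors w s -> (0 < k0)%N -> walk (vter s) p ->
          is_vertex (extend s p k0) <-> is_vertex (extend (f s) p k0)].

Definition ntype (w : vertex) : set vertex :=
  [set w' | is_vertex w' /\ vertex_equiv w w'].

Definition gftc_for : Prop :=
  [/\ invariant_family Omega, nested_index_sets F &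
      finite_set (ntype @` is_vertex)].

Definition gedge_to (w : vertex) (p : seq E) (w' : vertex) : Prop :=
  exists u v : dpath,
    [/\ u \in F (vlev w), v \in F (vlev w).+1,
        w = vertex_of (vlev w) u, w' = vertex_of (vlev w).+1 v &
        v = (u.1, u.2 ++ p)].

Definition pruned_edge (w : vertex) (p : seq E) (w' : vertex) : Prop :=
  gedge_to w p w' /\
  forall w2 p2, gedge_to w2 p2 w' -> ((p : seqlexi E) <= p2)%O.

(* Vertices without offspring, and those that lead only to such vertices *)
Inductive removed : vertex -> Prop :=
| Removed w : (forall p w', pruned_edge w p w' -> removed w') -> removed w.

Definition reduced_vertex (w : vertex) : Prop := is_vertex w /\ ~ removed w.

Definition reduced_edge (w : vertex) (p : seq E) (w' : vertex) : Prop :=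
  [/\ pruned_edge w p w', reduced_vertex w & reduced_vertex w'].

Definition enumerates_types (q : nat) (T : 'I_q -> set vertex) : Prop :=
  injective T /\ range T = ntype @` reduced_vertex.

(* Row i is the one computed from w, whichever w of type T i is chosen. The
   label of an edge leaving w determines its end, and each offspring of w is
   reached by one edge, so the sum over offspring is a sum over labels. *)
Definition weighted_incidence (q : nat) (T : 'I_q -> set vertex) (alpha : R)
    (A : 'M[R]_q) : Prop :=
  forall (i : 'I_q) (w : vertex), reduced_vertex w -> ntype w = T i ->
  forall j : 'I_q,
    A i j = \sum_(p \in [set p : seq E | exists w',
                          reduced_edge w p w' /\ ntype w' = T j])
              (path_ratio p `^ alpha).

End Types.
End GraphDirected.

(* Main.v *)
(* Iterating a loop of G brings any ball centred on the attractor into a Euclidean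
   chart, so that these balls embed, after rescaling, in a fixed Euclidean space:
   they are uniformly doubling. Similitudes are open (scaled isometries of
   Euclidean balls are onto) with closed range, hence surjective since M is
   connected. It follows that the parent of a vertex of the pruned graph is unique,
   so that the reduced graph is a forest, and that neighbours of vertices of the
   same type have the same relative sizes.

   On the matrix side, a nonnegative matrix B satisfies either h <= B h for some
   h >= 0, h <> 0, or B g < g for some g > 0, according to whether its spectral
   radius is at least 1 or not. Chains of edges of ratio 1 are bounded, so the
   spectral radius of A_s decreases strictly and crosses 1 exactly once, at alpha.

   For s > alpha, the weights rho_w^s g([w]) have level sums that tend to 0, and the
   cells of a level of the reduced graph cover K. For s <= alpha, the weights
   rho_w^s h([w]) are dominated by the sum over the offspring, so their sum over any
   cut of the forest is at least the weight of the root; as boundedly many cells of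
   size about r meet a ball of radius r, this gives a mass distribution bound. *)
Require Import Defs.
From HB Require Import structures.
From mathcomp Require Import all_boot all_order all_algebra finmap.
From mathcomp Require Import all_classical all_reals all_analysis.
From mathcomp Require Import complex ring lra.

Set Implicit Arguments.
Unset Strict Implicit.
Unset Printing Implicit Defensive.

Import Order.TTheory GRing.Theory Num.Theory.
Import numFieldNormedType.Exports.

Local Open Scope classical_set_scope.
Local Open Scope ring_scope.

(** * Spectral radius of nonnegative matrices *)

(** The graph of types need not be strongly connected, so there may be no positive Perron
    eigenvector; two one-sided vector inequalities replace it, and they can be followed as the
    exponent tends to a supremum. Nested index sets may keep a path unchanged from one level to the
    next; such an edge has ratio 1, so that neither the level nor the number of edges controls the
    size of a cell. Stopping rules therefore use the ratio times a potential depending on the type,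
    which shrinks by a fixed factor along each edge and stays comparable to the ratio. Constants
    uniform over infinitely many vertices come from two sources: representatives of the finitely
    many types, and the entries of [A s] at well-chosen exponents [s], which reveal single labels.
    The lower bound constructs no measure on the attractor: compactness leaves finitely many balls,
    and an inequality over a finite cut suffices. *)

Lemma finite_bound (R : realDomainType) (I : finType) (f : I -> R) (m : R) :
  exists2 C, m < C & forall i, f i < C.
Proof.
exists (\big[Num.max/m]_i f i + 1) => [|i]; rewrite ltr_pwDr//.
  exact: bigmax_ge_id.
exact: le_bigmax.
Qed.

Lemma finite_lt_bound (R : realFieldType) (I : finType) (f : I -> R) (c m : R) :
  m < c -> (forall i, f i < c) -> exists2 k, m < k < c & forall i, f i <= k.
Proof.
move=> mc fc; pose m' := (m + c) / 2.
exists (\big[Num.max/m']_i f i); last by move=> i; exact: le_bigmax.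
apply/andP; split; first by apply: lt_le_trans (bigmax_ge_id _ _ _ _); rewrite /m'; lra.
by apply/bigmax_ltP; split=> //; rewrite /m'; lra.
Qed.

Section Collatz_Wielandt.
Variable R : realType.

(** Reducible matrices occur, so [h] may vanish somewhere, whereas the [g] below is positive
    everywhere and can be divided by. *)
Definition superinvariant q (A : 'I_q -> 'I_q -> R) (c : R) :=
  exists h : 'I_q -> R, [/\ forall i, 0 <= h i, exists i, 0 < h i &
    forall i, c * h i <= \sum_j A i j * h j].

Definition strictly_subinvariant q (A : 'I_q -> 'I_q -> R) (c : R) :=
  exists2 g : 'I_q -> R, forall i, 0 < g i &
    forall i, \sum_j A i j * g j < c * g i.

(* Gaussian elimination of the first variable. *)
Lemma superinvariant_or_subinvariant1 q (A : 'I_q -> 'I_q -> R) :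
  (forall i j, 0 <= A i j) -> superinvariant A 1 \/ strictly_subinvariant A 1.
Proof.
elim: q A => [A _|q IH A A0].
  by right; exists (fun=> 1) => -[].
have [a1|a1] := leP 1 (A ord0 ord0).
  left; exists (fun i => (i == ord0)%:R); split=> [i||i].
  - by rewrite ler0n.
  - by exists ord0; rewrite eqxx ltr01.
  - rewrite (bigD1 ord0)//= mulr1 mul1r.
    apply: ler_wpDr; first by apply: sumr_ge0 => j _; rewrite mulr_ge0.
    by case: eqVneq => [->|_].
pose d := 1 - A ord0 ord0; have d0 : 0 < d by rewrite subr_gt0.
pose l := lift (ord0 : 'I_q.+1).
(* Schur complement of the pivot [1 - A 0 0] in [1 - A]. *)
pose B i j := A (l i) (l j) + A (l i) ord0 * A ord0 (l j) / d.
have BE (x : 'I_q -> R) i : \sum_j B i j * x j =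
    \sum_j A (l i) (l j) * x j + A (l i) ord0 * ((\sum_j A ord0 (l j) * x j) / d).
  rewrite mulrA mulr_sumr mulr_suml -big_split; apply: eq_bigr => j _ /=.
  by rewrite /B; ring.
case: (IH B) => [i j|[h [h0 [i0 hi0] Bh]]|[g g0 Bg]].
- by rewrite addr_ge0// divr_ge0 ?(ltW d0)// mulr_ge0.
- left; pose t := (\sum_j A ord0 (l j) * h j) / d.
  have t0 : 0 <= t.
    by rewrite divr_ge0 ?(ltW d0)// sumr_ge0// => j _; rewrite mulr_ge0.
  pose h' i := if unlift ord0 i is Some j then h j else t.
  have h'0 : h' ord0 = t by rewrite /h' unlift_none.
  have h'S j : h' (l j) = h j by rewrite /h' liftK.
  exists h'; split=> [i||i].
  + by rewrite /h'; case: unliftP.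
  + by exists (l i0); rewrite h'S.
  + rewrite big_ord_recl h'0 (eq_bigr (fun j => A i (l j) * h j)); last first.
      by move=> j _; rewrite h'S.
    rewrite mul1r; case: (unliftP ord0 i) => [j ->|->].
      rewrite h'S; have := Bh j; rewrite mul1r => /le_trans; apply.
      by rewrite BE addrC.
    rewrite h'0; have : d * t = \sum_j A ord0 (l j) * h j.
      by rewrite mulrC divfK// gt_eqF.
    by move=> <-; rewrite -mulrDl /d addrC subrK mul1r.
- right.
  have Bg' i : 0 < g i - \sum_j B i j * g j by have := Bg i; rewrite mul1r subr_gt0.
  (* Solving row 0 exactly would give an equality there; the slack of the other rows leaves room to
     raise the first coordinate by [e]. *)
  have [e e0 He] : exists2 e, 0 < e & forall i, A (l i) ord0 * e < g i - \sum_j B i j * g j.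
    have [C C0 HC] := finite_bound (fun i => A (l i) ord0 / (g i - \sum_j B i j * g j)) 0.
    exists C^-1 => [|i]; first by rewrite invr_gt0.
    by rewrite ltr_pdivrMr// mulrC -ltr_pdivrMr.
  pose t := (\sum_j A ord0 (l j) * g j) / d.
  have t0 : 0 <= t.
    rewrite divr_ge0 ?(ltW d0)// sumr_ge0// => j _.
    by rewrite mulr_ge0// ltW.
  pose g' i := if unlift ord0 i is Some j then g j else t + e.
  have g'0 : g' ord0 = t + e by rewrite /g' unlift_none.
  have g'S j : g' (l j) = g j by rewrite /g' liftK.
  exists g' => [i|i].
    by rewrite /g'; case: unliftP => // _; rewrite ltr_wpDl.
  rewrite big_ord_recl g'0 (eq_bigr (fun j => A i (l j) * g j)); last first.
    by move=> j _; rewrite g'S.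
  rewrite mul1r; case: (unliftP ord0 i) => [j ->|->].
    rewrite g'S; have := He j; rewrite BE -/t /l; lra.
  rewrite g'0; have -> : \sum_j A ord0 (l j) * g j = d * t.
    by rewrite mulrC divfK// gt_eqF.
  have := mulr_gt0 d0 e0; rewrite /d; lra.
Qed.

Lemma strictly_subinvariant_lt q (A : 'I_q -> 'I_q -> R) c : strictly_subinvariant A c ->
  exists2 c', c' < c & strictly_subinvariant A c'.
Proof.
move=> [g g0 Ag].
have Agc i : (\sum_j A i j * g j) / g i < c by rewrite ltr_pdivrMr.
have c1 : c - 1 < c by rewrite gtrBl.
have [k /andP[_ kc] Hk] := finite_lt_bound c1 Agc.
exists ((k + c) / 2); first by lra.
exists g => // i; have := Hk i; rewrite ler_pdivrMr// => /le_lt_trans; apply.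
by rewrite ltr_pM2r//; lra.
Qed.

Section spectral_radius.
Variables (q : nat) (A : 'M[R]_q).
Hypothesis A0 : forall i j, 0 <= A i j.

Lemma superinvariant_or_subinvariant c : 0 < c ->
  superinvariant A c \/ strictly_subinvariant A c.
Proof.
move=> c0; have Ac i j : 0 <= A i j / c by rewrite divr_ge0// ltW.
have E (h : 'I_q -> R) i : \sum_j A i j / c * h j = (\sum_j A i j * h j) / c.
  by rewrite mulr_suml; apply: eq_bigr => j _; rewrite mulrAC.
case: (superinvariant_or_subinvariant1 Ac) => [[h [h0 hi Ah]]|[g g0 Ag]].
  left; exists h; split=> // i; have := Ah i.
  by rewrite E mul1r ler_pdivlMr// mulrC.
by right; exists g => // i; have := Ag i; rewrite E mul1r ltr_pdivrMr// mulrC.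
Qed.

Lemma superinvariantW c c' : c' <= c -> superinvariant A c -> superinvariant A c'.
Proof.
move=> cc [h [h0 hi Ah]]; exists h; split=> // i.
by apply: le_trans (Ah i); rewrite ler_wpM2r.
Qed.

(** Minimum principle: where [x / g] is smallest, a negative minimum [t] would make the row
    inequality for [x] contradict the strict one for [t * g]. This is the inverse positivity of
    [c - A]. *)
Lemma resolvent_ge0 c (g x : 'I_q -> R) :
  (forall i, 0 < g i) -> (forall i, \sum_j A i j * g j < c * g i) ->
  (forall i, \sum_j A i j * x j <= c * x i) -> forall i, 0 <= x i.
Proof.
move=> g0 Ag Ax i; rewrite leNgt; apply/negP => xi.
have [j _ Hj] := @arg_minP _ _ _ i predT (fun j => x j / g j) isT.
set t := x j / g j in Hj.
have xj : x j = t * g j by rewrite divfK// gt_eqF.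
have t0 : t < 0.
  by apply: le_lt_trans (Hj i isT) _; rewrite pmulr_llt0 ?invr_gt0.
have xk k : t * g k <= x k by rewrite -ler_pdivlMr// Hj.
have : t * \sum_k A j k * g k <= c * x j.
  apply: le_trans (Ax j); rewrite mulr_sumr; apply: ler_sum => k _.
  by rewrite mulrCA ler_wpM2l.
by rewrite xj mulrCA ler_nM2l// leNgt Ag.
Qed.

Lemma superinvariant_subinvariantF c :
  superinvariant A c -> strictly_subinvariant A c -> False.
Proof.
move=> [h [h0 [i hi] Ah]] [g g0 Ag].
suff : 0 <= - h i by rewrite oppr_ge0 leNgt hi.
apply: (@resolvent_ge0 c g (fun i => - h i)) => // j.
rewrite mulrN (eq_bigr (fun k => - (A j k * h k))) => [|k _]; last by rewrite mulrN.
by rewrite sumrN lerN2.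
Qed.

(** Triangle inequality for the moduli of a right eigenvector. [eigenvalue] provides a left one; the
    vanishing determinant gives the other. *)
Lemma eigenvalue_superinvariant (z : R[i]) :
  eigenvalue (map_mx (real_complex R) A) z -> superinvariant A (Normc.normc z).
Proof.
move=> /eigenvalueP[v Av v0].
have /det0P[u u0 Hu] : \det (z%:M - map_mx (real_complex R) A)^T == 0.
  rewrite det_tr; apply/det0P; exists v => //.
  by rewrite mulmxBr Av mul_mx_scalar subrr.
exists (fun i => Normc.normc (u 0 i)); split=> [i||i].
- by case: (u 0 i) => a b; exact: sqrtr_ge0.
- have /rV0Pn[i ui] := u0; exists i; rewrite lt_neqAle; apply/andP; split.
    by apply/eqP => /esym/Normc.eq0_normc/eqP; exact/negP.
  by case: (u 0 i) => a b; exact: sqrtr_ge0.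
- have /matrixP/(_ 0 i) := Hu.
  rewrite !mxE => /eqP.
  rewrite (eq_bigr (fun j => (z *+ (i == j)) * u 0 j - real_complex R (A i j) * u 0 j)); last first.
    by move=> j _; rewrite !mxE mulrC mulrBl.
  rewrite sumrB subr_eq0 (bigD1 i)//= eqxx mulr1n big1 ?addr0; last first.
    by move=> j ji; rewrite eq_sym (negPf ji) mulr0n mul0r.
  move=> /eqP/(congr1 (@Normc.normc R)); rewrite Normc.normcM => ->.
  elim/big_rec2: _ => [|j x y _ xy]; first by rewrite Normc.normc0.
  apply: le_trans (le_normcD _ _) _; rewrite lerD// Normc.normcM.
  by rewrite /Normc.normc /= expr0n /= addr0 sqrtr_sqr ger0_norm.
Qed.

Lemma strictly_subinvariantW c c' : c <= c' ->
  strictly_subinvariant A c -> strictly_subinvariant A c'.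
Proof.
move=> cc [g g0 Ag]; exists g => // i.
by apply: lt_le_trans (Ag i) _; rewrite ler_wpM2r// ltW.
Qed.

Lemma large_strictly_subinvariant : exists2 c, 0 < c & strictly_subinvariant A c.
Proof.
have [c c0 Hc] := finite_bound (fun i => \sum_j A i j * 1) 0.
by exists c => //; exists (fun=> 1) => // i; rewrite mulr1.
Qed.

Lemma eigenvalue_lt c (z : R[i]) : 0 < c -> strictly_subinvariant A c ->
  eigenvalue (map_mx (real_complex R) A) z -> Normc.normc z < c.
Proof.
move=> c0 Qc /eigenvalue_superinvariant Pz; rewrite ltNge; apply/negP => cz.
by apply: superinvariant_subinvariantF Qc; exact: superinvariantW Pz.
Qed.

Lemma spectral_radius_lt c : 0 < c -> strictly_subinvariant A c ->
  spectral_radius A < c.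
Proof.
move=> c0 /strictly_subinvariant_lt[c' cc' Qc'].
(* [c'] may fail to be positive, and without eigenvalues the supremum is 0; [c2] is a positive bound
   that covers both cases. *)
pose c2 := Num.max c' (c / 2).
have c2c : c2 < c by rewrite gt_max cc'/=; lra.
have c20 : 0 < c2 by rewrite lt_max; apply/orP; right; lra.
apply: le_lt_trans c2c; rewrite /spectral_radius.
set S := [set Normc.normc z | z in _].
have [->|/set0P S0] := eqVneq S set0; first by rewrite sup0 ltW.
apply: ge_sup => // _ [z zA <-]; apply/ltW/eigenvalue_lt => //.
by apply: strictly_subinvariantW Qc'; rewrite le_max lexx.
Qed.

Lemma eigenvalue_le_spectral_radius (z : R[i]) :
  eigenvalue (map_mx (real_complex R) A) z -> Normc.normc z <= spectral_radius A.
Proof.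
move=> zA; apply: ub_le_sup; last by exists z.
have [c c0 Qc] := large_strictly_subinvariant.
by exists c => _ [y yA <-]; apply/ltW/eigenvalue_lt.
Qed.

Lemma horner_ge0_right (p : {poly R}) (l : R) :
  (forall x, l < x -> 0 <= p.[x]) -> 0 <= p.[l].
Proof.
move=> pl; have : p.[x] @[x --> l^'+] --> p.[l].
  by apply: cvg_at_right_filter; exact: continuous_horner.
move=> pc; rewrite -(cvg_lim _ pc)//; apply: limr_ge; first exact: cvgP pc.
near=> x; apply: pl.
by near: x; exact: nbhs_right_gt.
Unshelve. all: by end_near. Qed.

(* The solution x of (l - A) x = 1 is nonnegative for l > L, hence also at
   l = L unless L is an eigenvalue; but then A x < L x. *)
Lemma superinvariant_le_spectral_radius c : 0 < c ->
  superinvariant A c -> c <= spectral_radius A.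
Proof.
move=> c0 Pc; pose S := [set l | 0 < l /\ superinvariant A l].
have Sub : has_ubound S.
  have [b b0 Qb] := large_strictly_subinvariant.
  exists b => l [l0 Pl]; rewrite leNgt; apply/negP => bl.
  by apply: superinvariant_subinvariantF Qb; apply: superinvariantW Pl; exact: ltW.
have S0 : S !=set0 by exists c.
pose L := sup S; have cL : c <= L by apply: ub_le_sup.
have L0 : 0 < L by exact: lt_le_trans cL.
have QL l : L < l -> strictly_subinvariant A l.
  move=> Ll; have l0 := lt_trans L0 Ll.
  case: (superinvariant_or_subinvariant l0) => // Pl.
  suff : l <= L by rewrite leNgt Ll.
  exact: ub_le_sup.
have PL : superinvariant A L.
  (* A strict inequality at [L] would persist at some [l < L], hence contradict an element of [S]
     above [l]. *)
  case: (superinvariant_or_subinvariant L0) => // /strictly_subinvariant_lt[l lL Ql].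
  have eL : 0 < L - l by rewrite subr_gt0.
  have [l' [_ Pl'] ll'] := sup_adherent eL (conj S0 Sub).
  exfalso; apply: superinvariant_subinvariantF Ql; apply: superinvariantW Pl'.
  by rewrite ltW// (le_lt_trans _ ll')// -/L subKr.
suff : eigenvalue (map_mx (real_complex R) A) (real_complex R L).
  move=> /eigenvalue_le_spectral_radius; apply: le_trans.
  by rewrite /Normc.normc /= expr0n /= addr0 sqrtr_sqr ger0_norm// ltW.
rewrite eigenvalue_root_char -map_char_poly fmorph_root.
apply/negPn/negP => DL.
(* The adjugate applied to the all-ones vector: [y] divided by the characteristic polynomial solves
   [(l - A) x = 1]. *)
pose y i := \sum_j (\adj (char_poly_mx A)) i j.
have DE i : char_poly A = \sum_j char_poly_mx A i j * y j.
  have : \sum_k (char_poly_mx A *m \adj (char_poly_mx A)) i k = char_poly A.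
    rewrite mul_mx_adj (bigD1 i)//= !mxE eqxx mulr1n big1 ?addr0// => k ki.
    by rewrite !mxE eq_sym (negPf ki) mulr0n.
  move=> <-; under eq_bigr do rewrite mxE.
  by rewrite exchange_big; apply: eq_bigr => j _; rewrite mulr_sumr.
have yE l i : l * (y i).[l] - \sum_j A i j * (y j).[l] = (char_poly A).[l].
  rewrite (DE i) [RHS]horner_sum.
  rewrite [RHS](eq_bigr (fun j => (i == j)%:R * l * (y j).[l] - A i j * (y j).[l])).
    rewrite sumrB; congr (_ - _); rewrite (bigD1 i)//= eqxx mul1r.
    rewrite big1 ?addr0// => j ji.
    by rewrite eq_sym (negPf ji) !mul0r.
  move=> j _; rewrite hornerM -mulrBl; congr (_ * _).
  by rewrite !mxE hornerD hornerN hornerC hornerMn hornerX mulr_natl.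
set D := char_poly A in DL yE.
(* One more factor [D] turns the right-hand side into the square of [D], which is nonnegative
   whatever the sign of [D] and nonzero away from its roots. *)
pose x l i := (y i * D).[l].
have xE l i : l * x l i - \sum_j A i j * x l j = D.[l] ^+ 2.
  rewrite expr2 -{1}(yE l i) mulrBl mulr_suml /x hornerM mulrA.
  by congr (_ - _); apply: eq_bigr => j _; rewrite hornerM mulrA.
have x0 i : 0 <= x L i.
  apply: horner_ge0_right => l Ll; have [g g0 Ag] := QL _ Ll.
  apply: (resolvent_ge0 (x := x l) g0 Ag) => j.
  by rewrite -subr_ge0 xE sqr_ge0.
have Axx i : \sum_j A i j * x L j < L * x L i.
  by rewrite -subr_gt0 xE exprn_even_gt0.
apply: superinvariant_subinvariantF PL _; exists (x L) => // i.
rewrite -(pmulr_rgt0 _ L0); apply: le_lt_trans (Axx i).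
by apply: sumr_ge0 => j _; rewrite mulr_ge0.
Qed.

End spectral_radius.
End Collatz_Wielandt.

(** * The exponent at which the spectral radius equals 1 *)

Lemma powR_eq_exponent (R : realType) (k c : R) : 0 < k < 1 -> 0 < c < 1 ->
  exists2 e, 0 < e & k `^ e = c.
Proof.
move=> /andP[k0 k1] /andP[c0 c1]; have lk : ln k < 0 by rewrite ln_lt0// k0.
exists (ln c / ln k); first by rewrite nmulr_rgt0 ?invr_lt0// ln_lt0// c0.
by rewrite /powR gt_eqF// divfK ?lnK// lt_eqF.
Qed.

(* The hypothesis on [G] says that the weights become uniformly less than 1
   after conjugating the matrices by the diagonal matrix of the [G i]. *)
Lemma pressure_zero (R : realType) q (P : 'I_q -> 'I_q -> seq R)
    (A : R -> 'M[R]_q) (m k : R) (G : 'I_q -> R) (i0 : 'I_q) :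
  (forall s i j, A s i j = \sum_(r <- P i j) r `^ s) ->
  0 < m < 1 -> (forall i j r, r \in P i j -> m <= r <= 1) ->
  0 < k < 1 -> (forall i, 0 < G i) ->
  (forall i j r, r \in P i j -> r * G j <= k * G i) ->
  (forall i, exists j, P i j != [::]) ->
  exists alpha : R, [/\ 0 <= alpha, spectral_radius (A alpha) = 1,
    forall b, spectral_radius (A b) = 1 -> b = alpha,
    forall s, s <= alpha -> superinvariant (A s) 1 &
    forall s, alpha < s -> strictly_subinvariant (A s) 1].
Proof.
move=> AE m01 Pm k01 G0 PG Pn; have [m0 m1] := andP m01; have [k0 k1] := andP k01.
have A0 s i j : 0 <= A s i j by rewrite AE sumr_ge0// => r _; exact: powR_ge0.
have anti s t i j : s <= t -> A t i j <= A s i j.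
  move=> st; rewrite !AE big_seq [leRHS]big_seq; apply: ler_sum => r /Pm/andP[mr r1].
  by apply: ger_powR => //; rewrite r1 (lt_le_trans m0).
have lowerA s t i j : s <= t -> m `^ (t - s) * A s i j <= A t i j.
  move=> st; rewrite !AE mulr_sumr big_seq [leRHS]big_seq; apply: ler_sum.
  move=> r /Pm/andP[mr r1]; have r0 := lt_le_trans m0 mr.
  rewrite -[in leRHS](subrK s t) [in leRHS]powRD ?(gt_eqF r0) ?implybT//.
  by rewrite ler_wpM2r ?powR_ge0// ge0_ler_powR ?subr_ge0// ?nnegrE ltW.
have P_anti s t c : s <= t -> superinvariant (A t) c -> superinvariant (A s) c.
  move=> st [h [h0 hi Ah]]; exists h; split=> // i; apply: le_trans (Ah i) _.
  by apply: ler_sum => j _; rewrite ler_wpM2r ?anti.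
have P_lower s t c : s <= t -> superinvariant (A s) c ->
    superinvariant (A t) (m `^ (t - s) * c).
  move=> st [h [h0 hi Ah]]; exists h; split=> // i.
  rewrite -mulrA; apply: le_trans (ler_wpM2l (powR_ge0 _ _) (Ah i)) _.
  rewrite mulr_sumr; apply: ler_sum => j _.
  by rewrite mulrA ler_wpM2r ?lowerA.
(* At exponent 0 the entries count labels, and every row has at least one. *)
have P0 : superinvariant (A 0) 1.
  exists (fun=> 1); split=> [//||i]; first by exists i0.
  have [j Pj] := Pn i; rewrite (bigD1 j)//= !mulr1.
  apply: ler_wpDr; first by apply: sumr_ge0 => l _; rewrite mulr1.
  rewrite AE; case: (P i j) Pj => // r s _; rewrite big_cons powRr0.
  by rewrite lerDl sumr_ge0// => l _; exact: powR_ge0.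
pose S := [set s | superinvariant (A s) 1].
(* [C] exceeds the number of labels in each row; once [k] to the power [b] is [1 / C], the vector of
   the [G i] to the power [b] is strictly subinvariant. *)
have Sub : has_ubound S.
  pose N i : R := (\sum_j (size (P i j))%:R).
  have [C C1 HC] := finite_bound N 1.
  have C0 : 0 < C by exact: lt_trans C1.
  have [|b b0 kb] := @powR_eq_exponent _ k C^-1 k01.
    by rewrite invr_gt0 C0 invf_lt1.
  exists b => s Ps; rewrite leNgt; apply/negP => bs.
  apply: (superinvariant_subinvariantF (A0 b)) (P_anti _ _ _ (ltW bs) Ps) _.
  exists (fun i => G i `^ b) => i; first exact: powR_gt0.
  apply: (@le_lt_trans _ _ (N i * (k `^ b * G i `^ b))).
    rewrite /N mulr_suml; apply: ler_sum => j _.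
    have -> x : (size (P i j))%:R * x = \sum_(r <- P i j) x.
      by rewrite big_const_seq count_predT iter_addr_0 mulr_natl.
    rewrite AE mulr_suml big_seq [leRHS]big_seq; apply: ler_sum => r Pr.
    have /andP[mr _] := Pm _ _ _ Pr; have r0 := lt_le_trans m0 mr.
    rewrite -!powRM ?(ltW r0) ?(ltW (G0 _)) ?(ltW k0)//.
    by rewrite ge0_ler_powR ?(ltW b0)// ?nnegrE ?mulr_ge0 ?PG// ltW.
  by rewrite mulrA ltr_pM2r ?powR_gt0// kb ltr_pdivrMr// mul1r.
have S0 : S !=set0 by exists 0.
pose alpha := sup S.
have alpha0 : 0 <= alpha by apply: ub_le_sup.
have Q s : alpha < s -> strictly_subinvariant (A s) 1.
  move=> sa; case: (superinvariant_or_subinvariant (A0 s) ltr01) => // Ps.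
  by exfalso; move: sa; rewrite ltNge => /negP; apply; exact: ub_le_sup.
(* Continuity from the left: [P_lower] loses only a power of [m] that tends to 1 as [s] increases to
   [alpha], while the strict inequality leaves room for a factor [c < 1]. *)
have Pa : superinvariant (A alpha) 1.
  case: (superinvariant_or_subinvariant (A0 alpha) ltr01) => //.
  move=> /strictly_subinvariant_lt[c c1 Qc]; exfalso.
  pose c' := Num.max c 2^-1.
  have c'1 : c' < 1 by rewrite gt_max c1/=; lra.
  have c'0 : 0 < c' by rewrite lt_max; apply/orP; right; lra.
  have [|e e0 me] := @powR_eq_exponent _ m c' m01; first by rewrite c'0.
  have [s Ss es] := sup_adherent e0 (conj S0 Sub).
  have sa : s <= alpha by apply: ub_le_sup.
  apply: (superinvariant_subinvariantF (A0 alpha)) (P_lower _ _ _ sa Ss) _.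
  apply: strictly_subinvariantW Qc; rewrite mulr1.
  apply: (@le_trans _ _ c'); first by rewrite le_max lexx.
  rewrite -me; apply: ger_powR; first by rewrite m0 ltW.
  by rewrite lerBlDl -lerBlDr ltW.
have Pge s : s <= alpha -> superinvariant (A s) 1 by move=> sa; exact: P_anti Pa.
exists alpha; split=> //.
- apply/eqP; rewrite eq_le; apply/andP; split; last first.
    exact: superinvariant_le_spectral_radius.
  rewrite leNgt; apply/negP => sr1; set c := spectral_radius _ in sr1.
  have c0 : 0 < c := lt_trans ltr01 sr1.
  case: (superinvariant_or_subinvariant (A0 alpha) c0); last first.
    by move=> /(spectral_radius_lt (A0 alpha) c0); rewrite ltxx.
  (* A spectral radius [c > 1] could be traded for a larger exponent: [e] makes the loss exactly
     [1 / c]. *)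
  move=> Pc; have [|e e0 me] := @powR_eq_exponent _ m c^-1 m01.
    by rewrite invr_gt0 c0 invf_lt1.
  have ae : alpha < alpha + e by rewrite ltrDl.
  have := P_lower _ _ _ (ltW ae) Pc; rewrite addrAC subrr add0r me mulVf ?gt_eqF//.
  by move=> P1; exact: (superinvariant_subinvariantF (A0 _) P1 (Q _ ae)).
- move=> b srb; have [ba|ab|//] := ltgtP b alpha; last first.
    by have := spectral_radius_lt (A0 b) ltr01 (Q _ ab); rewrite srb ltxx.
  exfalso; have [h [h0 [i hi] Ah]] := Pa.
  have c1 : 1 < k `^ (b - alpha).
    rewrite -(opprB alpha) powRN invf_gt1 ?powR_gt0//.
    have -> : 1 = 1 `^ (alpha - b) :> R by rewrite powR1.
    by rewrite gt0_ltr_powR ?subr_gt0// ?nnegrE ltW.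
  (* Reweighting by powers of [G] shows that a lower exponent gains a power of [k] that exceeds 1;
     this is the strict monotonicity. *)
  have : superinvariant (A b) (k `^ (b - alpha)).
    exists (fun i => G i `^ (b - alpha) * h i); split=> [j||j].
    + by rewrite mulr_ge0 ?powR_ge0.
    + by exists i; rewrite mulr_gt0 ?powR_gt0.
    + rewrite mulrA -powRM ?(ltW k0) ?(ltW (G0 _))//.
      apply: (@le_trans _ _ ((k * G j) `^ (b - alpha) * \sum_l A alpha j l * h l)).
        by rewrite ler_wpM2l ?powR_ge0//; have := Ah j; rewrite mul1r.
      rewrite mulr_sumr; apply: ler_sum => l _; rewrite mulrA [leRHS]mulrA.
      rewrite ler_wpM2r// !AE mulr_suml mulr_sumr big_seq [leRHS]big_seq.
      apply: ler_sum => r Pr; have /andP[mr _] := Pm _ _ _ Pr.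
      have r0 := lt_le_trans m0 mr.
      have -> : r `^ b = r `^ (b - alpha) * r `^ alpha.
        by rewrite -powRD ?subrK// (gt_eqF r0) implybT.
      rewrite [leRHS]mulrAC ler_wpM2r ?powR_ge0// -powRM ?(ltW r0) ?(ltW (G0 _))//.
      rewrite -(opprB alpha) !powRN lef_pV2 ?posrE ?powR_gt0 ?mulr_gt0//.
      by rewrite ge0_ler_powR ?subr_ge0 ?(ltW ba)// ?nnegrE ?PG// mulr_ge0// ltW.
  move=> /(superinvariant_le_spectral_radius (A0 b) (lt_trans ltr01 c1)).
  by rewrite srb leNgt c1.
Qed.

(** * Euclidean geometry *)

Section Euclidean.
Variable R : realType.

Definition dotp m (u v : 'rV[R]_m) : R := (u *m v^T) 0 0.

Lemma dotpE m (u v : 'rV[R]_m) : dotp u v = \sum_i u 0 i * v 0 i.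
Proof. by rewrite /dotp mxE; apply: eq_bigr => i _; rewrite mxE. Qed.

Lemma dotpC m (u v : 'rV[R]_m) : dotp u v = dotp v u.
Proof. by rewrite !dotpE; apply: eq_bigr => i _; rewrite mulrC. Qed.

Lemma dotp_subl m (u v w : 'rV[R]_m) : dotp (u - v) w = dotp u w - dotp v w.
Proof. by rewrite /dotp mulmxBl !mxE. Qed.

Lemma dotpZ m a (u : 'rV[R]_m) : dotp (a *: u) (a *: u) = a ^+ 2 * dotp u u.
Proof.
by rewrite !dotpE mulr_sumr; apply: eq_bigr => i _; rewrite !mxE mulrACA expr2.
Qed.

Lemma dotp_ge0 m (u : 'rV[R]_m) : 0 <= dotp u u.
Proof. by rewrite dotpE sumr_ge0// => i _; rewrite -expr2 sqr_ge0. Qed.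

Lemma euclidean_distE m (u v : 'rV[R]_m) :
  euclidean_dist u v = Num.sqrt (dotp (u - v) (u - v)).
Proof.
rewrite /euclidean_dist dotpE; congr Num.sqrt; apply: eq_bigr => i _.
by rewrite !mxE expr2.
Qed.

Lemma sqr_euclidean_dist m (u v : 'rV[R]_m) :
  euclidean_dist u v ^+ 2 = dotp (u - v) (u - v).
Proof. by rewrite euclidean_distE sqr_sqrtr ?dotp_ge0. Qed.

Lemma dotp_polar m (u v c : 'rV[R]_m) : dotp (u - c) (v - c) =
  (euclidean_dist u c ^+ 2 + euclidean_dist v c ^+ 2 - euclidean_dist u v ^+ 2) / 2.
Proof.
rewrite !sqr_euclidean_dist.
have -> : u - v = (u - c) - (v - c) by rewrite opprB addrA subrK.
move: (u - c) (v - c) => a b.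
rewrite dotp_subl (dotpC a (a - b)) (dotpC b (a - b)) !dotp_subl (dotpC b a); lra.
Qed.

Lemma euclidean_dist_sym m (u v : 'rV[R]_m) : euclidean_dist u v = euclidean_dist v u.
Proof.
rewrite /euclidean_dist; congr Num.sqrt; apply: eq_bigr => i _.
by rewrite -sqrrN opprB.
Qed.

Lemma ler_euclidean_dist m (u v : 'rV[R]_m) i : `|u 0 i - v 0 i| <= euclidean_dist u v.
Proof.
rewrite -sqrtr_sqr /euclidean_dist ler_sqrt ?sumr_ge0// => [|j _]; last exact: sqr_ge0.
by rewrite (bigD1 i)//= lerDl sumr_ge0// => j _; exact: sqr_ge0.
Qed.

Section scaled_isometry.
Variables (m m' : nat) (g : 'rV[R]_m -> 'rV[R]_m') (c : 'rV[R]_m) (k e : R).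
Hypotheses (k0 : 0 < k) (e0 : 0 < e).
Hypothesis g_isom : forall x y, euclidean_dist c x < e -> euclidean_dist c y < e ->
  euclidean_dist (g x) (g y) = k * euclidean_dist x y.

Let cc : euclidean_dist c c < e.
Proof. by rewrite euclidean_distE subrr /dotp mul0mx mxE sqrtr0. Qed.

(** Polarization recovers inner products from distances, which makes [g] behave like an affine
    map. *)
Lemma scaled_isometry_dotp x y : euclidean_dist c x < e -> euclidean_dist c y < e ->
  dotp (g x - g c) (g y - g c) = k ^+ 2 * dotp (x - c) (y - c).
Proof. by move=> cx cy; rewrite !dotp_polar !g_isom//; lra. Qed.

(** The rows of [Q] are the normalized images of an orthogonal frame at [c]; the length [e / 2]
    keeps the frame inside the ball. *)
Let frame i : 'rV[R]_m := c + (e / 2) *: delta_mx 0 i.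
Let Q : 'M[R]_(m, m') := \matrix_(i, j) ((g (frame i) - g c) 0 j / (k * (e / 2))).

Let frameB i : frame i - c = (e / 2) *: delta_mx 0 i.
Proof. by rewrite /frame addrC addKr. Qed.

Let dotp_delta (u : 'rV[R]_m) i : dotp u (delta_mx 0 i) = u 0 i.
Proof.
rewrite dotpE (bigD1 i)//= mxE !eqxx mulr1 big1 ?addr0// => j ji.
by rewrite mxE eqxx (negPf ji) mulr0.
Qed.

Let dotp_frame (u : 'rV[R]_m) i : dotp u (frame i - c) = e / 2 * u 0 i.
Proof. by rewrite frameB dotpC /dotp -scalemxAl mxE -/(dotp _ _) dotpC dotp_delta. Qed.

Let frame_near i : euclidean_dist c (frame i) < e.
Proof.
rewrite euclidean_dist_sym -(ltr_pXn2r (n := 2)) ?nnegrE ?sqrtr_ge0 ?(ltW e0)//.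
rewrite sqr_euclidean_dist dotp_frame frameB !mxE !eqxx mulr1 -expr2.
by rewrite ltr_pXn2r ?nnegrE ?divr_ge0 ?(ltW e0)// ltr_pdivrMr// ltr_pMr// ltr1n.
Qed.

Let frame_dotp x i : euclidean_dist c x < e ->
  ((g x - g c) *m Q^T) 0 i = k * (x - c) 0 i.
Proof.
move=> cx; rewrite mxE.
transitivity (dotp (g x - g c) (g (frame i) - g c) / (k * (e / 2))).
  by rewrite dotpE mulr_suml; apply: eq_bigr => j _; rewrite [_^T _ _]mxE [Q _ _]mxE mulrA.
rewrite scaled_isometry_dotp// dotp_frame; move: ((x - c) 0 i) => t.
by field; rewrite !gt_eqF.
Qed.

Let QQ : Q *m Q^T = 1%:M.
Proof.
apply/matrixP => i j.
have -> : (Q *m Q^T) i j = ((g (frame i) - g c) *m Q^T) 0 j / (k * (e / 2)).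
  by rewrite !mxE mulr_suml; apply: eq_bigr => l _; rewrite [Q i l]mxE mulrAC.
rewrite frame_dotp// frameB !mxE eqxx /= (eq_sym j); move: ((i == j)%:R) => t.
by field; rewrite !gt_eqF.
Qed.

(** The [m] rows of [Q] are orthonormal in dimension [m']. *)
Lemma scaled_isometry_dim : (m <= m')%N.
Proof. exact: (mulmx1_min QQ). Qed.

(** In equal dimensions [Q] is orthogonal, so the preimage can be written down: add to [c] the
    vector [(z - g c) *m Q^T] divided by [k]. *)
Lemma scaled_isometry_onto z : m = m' -> euclidean_dist (g c) z < k * e ->
  exists2 x, euclidean_dist c x < e & g x = z.
Proof.
move=> mm' gz; have QTQ : Q^T *m Q = 1%:M.
  by case: _ / mm' (Q) QQ => N /mulmx1C.
pose a : 'rV[R]_m := k^-1 *: ((z - g c) *m Q^T).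
have ca : euclidean_dist c (c + a) < e.
  rewrite -(ltr_pM2l k0); apply: le_lt_trans gz.
  rewrite -(@ler_pXn2r _ 2) ?nnegrE ?mulr_ge0 ?sqrtr_ge0 ?(ltW k0)//.
  rewrite exprMn !(euclidean_dist_sym _ (c + a)) (euclidean_dist_sym (g c)).
  rewrite !sqr_euclidean_dist (addrC c) addrK dotpZ mulrA -exprMn.
  rewrite mulfV ?gt_eqF// expr1n mul1r /dotp trmx_mul trmxK mulmxA.
  by rewrite -(mulmxA _ Q^T) QTQ mulmx1.
exists (c + a) => //.
have : (g (c + a) - g c) *m Q^T = (z - g c) *m Q^T.
  apply/rowP => i; rewrite frame_dotp// addrC addKr !mxE mulrA mulfV ?gt_eqF// mul1r.
  by [].
move=> /(congr1 (mulmxr Q)); rewrite /= -!mulmxA QTQ !mulmx1 => /(congr1 (+%R^~ (g c))).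
by rewrite !subrK.
Qed.
End scaled_isometry.
End Euclidean.

(** * Similitudes of locally Euclidean manifolds *)

Section Manifold.
Variables (R : realType) (M : metricType R).

Lemma nbhs_mdist (x : M) (P : set M) :
  nbhs x P <-> exists2 r, 0 < r & forall y, mdist x y < r -> P y.
Proof.
rewrite -metricType_numDomainType.filter_from_mdist_nbhs.
by split=> -[r r0 H]; exists r.
Qed.

Lemma open_mdist (P : set M) : open P <->
  forall x, P x -> exists2 r, 0 < r & forall y, mdist x y < r -> P y.
Proof.
rewrite openE; split=> H x Px; first by have /nbhs_mdist := H x Px.
by apply/nbhs_mdist/H.
Qed.

Definition connected_space := forall W : set M,
  open W -> open (~` W) -> W !=set0 -> W = setT.

Section charts.
Variables (n : nat) (atlas : set (chart M R n)).
Variable (g : chart M R n -> 'rV[R]_n -> 'M[R]_n).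

Lemma chart_curve_clopen (c : chart M R n) x y l (W : set M) : is_chart c ->
  chart_curve g c x y l -> open W -> open (~` W) -> W x -> W y.
Proof.
move=> [_ oimg _ _ cinv] [u [[du _] uimg [u0 u1] _]] oW oNW Wx.
have cu : continuous u by move=> s; apply/differentiable_continuous/derivable1_diffP.
have gcont s : chart_img c (u s) -> chart_inv c (u t) @[t --> s] --> chart_inv c (u s).
  move=> us; apply: (continuous_comp (cu s)).
  by rewrite continuous_open_subspace// in cinv; apply: cinv; rewrite inE.
(* The curve is known to stay in the chart only on [[0, 1]], hence the restriction to parameters
   whose value lies in [chart_img c]. *)
have openpre (B : set M) : open B ->
    open [set s | chart_img c (u s) /\ B (chart_inv c (u s))].
  move=> oB; rewrite openE => s [us Bs].
  apply: filterI.
    by apply: (cu s (chart_img c)); apply: open_nbhs_nbhs; split.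
  by apply: (gcont s us B); apply: open_nbhs_nbhs; split.
have := @segment_connected R 0 1.
move=> /(_ (`[0, 1] `&` [set s | W (chart_inv c (u s))])) H.
suff : `[0, 1] `&` [set s | W (chart_inv c (u s))] = `[0, 1]%classic.
  move=> /seteqP[_ /(_ 1)]; rewrite /= -u1; case=> //.
  by rewrite in_itv /= ler01 lexx.
apply: H.
- by exists 0; split => /=; rewrite ?in_itv /= ?ler01 ?lexx// u0.
- exists [set s | chart_img c (u s) /\ W (chart_inv c (u s))]; first exact: openpre.
  apply/seteqP; split=> s /= [s01]; last by case.
  by move=> Ws; split=> //; split=> //; apply: uimg; move: s01; rewrite in_itv.
- exists (~` [set s | chart_img c (u s) /\ ~ W (chart_inv c (u s))]).
    by apply: open_closedC; exact: (openpre _ oNW).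
  apply/seteqP; split=> s /= [s01 Hs]; split=> //; first by case.
  apply: contrapT => nW; apply: Hs; split=> //.
  by apply: uimg; move: s01; rewrite in_itv.
Qed.

(** Distances are finite, whereas the infimum over no curve would be infinite; so any two points are
    joined by a curve. *)
Lemma riemannian_connected : riemannian_manifold atlas g -> connected_space.
Proof.
move=> [_ [chartP _ _] _ distP] W oW oNW [x Wx]; apply/seteqP; split=> // y _.
have [l] : exists l, curve_length atlas g x y l.
  apply: contrapT => nl; have := distP x y.
  rewrite (_ : [set _ | _ in _] = set0) ?ereal_inf0//.
  by apply/seteqP; split=> // z [l xyl _]; apply: nl; exists l.
move=> xyl; elim: xyl Wx => // c x1 z y1 l1 l2 ac xzl _ IH Wx1; apply: IH.
exact: chart_curve_clopen (chartP _ ac) xzl oW oNW Wx1.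
Qed.

Lemma atlas_two_points : (0 < n)%N -> is_atlas atlas -> forall x : M, exists y, y != x.
Proof.
move=> n0 [chartP cover _] x; have [c ac cx] := cover x.
have [_ oimg cK _ _] := chartP _ ac.
have : nbhs (chart_fun c x) (chart_img c) by apply: open_nbhs_nbhs; split=> //; exists x.
move=> /nbhs_ballP[e /= e0 He].
have [y cy yE] : chart_img c (chart_fun c x + const_mx (e / 2)).
  apply: He; split=> // i j; rewrite /ball /= !mxE opprD addrA subrr sub0r normrN.
  by rewrite gtr0_norm ?divr_gt0// ltr_pdivrMr// ltr_pMr// ltr1n.
exists y; apply: contraTneq isT => yx; move: yE; rewrite yx.
move=> /eqP; rewrite -subr_eq0 opprD addrA subrr sub0r oppr_eq0 => /eqP/rowP/(_ (Ordinal n0)).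
by rewrite !mxE => /eqP; rewrite gt_eqF// divr_gt0.
Qed.

End charts.

(** [locally_euclidean] lets the dimension vary with the point; here it is a parameter, shown later
    to be the same at all points. *)
Definition euclidean_at (m : nat) (x : M) := exists (U : set M) (f : M -> 'rV[R]_m),
  [/\ open U, U x, open (f @` U) &
      forall y z, U y -> U z -> euclidean_dist (f y) (f z) = mdist y z].

Definition euclidean_ball (m : nat) (x : M) (r : R) (f : M -> 'rV[R]_m) :=
  (forall y z, mdist x y < r -> mdist x z < r ->
     euclidean_dist (f y) (f z) = mdist y z) /\
  (forall v, euclidean_dist (f x) v < r -> exists2 y, mdist x y < r & f y = v).

Lemma euclidean_at_ball m x : euclidean_at m x ->
  exists2 r, 0 < r & exists f : M -> 'rV[R]_m, euclidean_ball x r f.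
Proof.
move=> [U [f [/open_mdist oU Ux ofU fU]]].
have [r r0 Hr] := oU _ Ux.
have : nbhs (f x) (f @` U) by apply: open_nbhs_nbhs; split=> //; exists x.
move=> /nbhs_ballP[e /= e0 He].
exists (Num.min r e); first by rewrite lt_min r0.
exists f; split=> [y z|v].
  by rewrite !lt_min => /andP[/Hr Uy _] /andP[/Hr Uz _]; exact: fU.
move=> fv; have [y Uy yE] : (f @` U) v.
  apply: He; split=> // i j; rewrite /ball /= ord1.
  apply: le_lt_trans (ler_euclidean_dist _ _ _) (lt_le_trans fv _).
  by rewrite ge_min lexx orbT.
by exists y => //; rewrite -fU// yE.
Qed.

(** In charts [S] becomes a map on a Euclidean ball that multiplies distances by [k]. [F] inverts
    [f], and [e] is small enough for [S] to land in the second ball. *)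
Lemma similitude_chart m m' x (S : M -> M) (k r r' : R)
    (f : M -> 'rV[R]_m) (f' : M -> 'rV[R]_m') :
  0 < k -> (forall y z, mdist (S y) (S z) = k * mdist y z) ->
  0 < r -> 0 < r' -> euclidean_ball x r f -> euclidean_ball (S x) r' f' ->
  exists (e : R) (F : 'rV[R]_m -> M),
  [/\ 0 < e, k * e <= r', F (f x) = x,
      forall v, euclidean_dist (f x) v < e -> mdist x (F v) < e &
      forall u v, euclidean_dist (f x) u < e -> euclidean_dist (f x) v < e ->
      euclidean_dist (f' (S (F u))) (f' (S (F v))) = k * euclidean_dist u v].
Proof.
move=> k0 Sk r0 r'0 [fr fr_onto] [fr' _].
pose e := Num.min r (r' / k).
have e0 : 0 < e by rewrite lt_min r0 divr_gt0.
have xx : mdist x x < r by rewrite mdistxx.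
pose F v := xget x [set y | mdist x y < r /\ f y = v].
have FP v : euclidean_dist (f x) v < e -> mdist x (F v) < r /\ f (F v) = v.
  rewrite lt_min => /andP[/fr_onto[y xy fy] _].
  by rewrite /F; case: xgetP => [z _ //|/(_ y)]; case.
have Fe v : euclidean_dist (f x) v < e -> mdist x (F v) < e.
  by move=> xv; have [xF FE] := FP v xv; rewrite -fr// FE.
have ker : k * e <= r' by rewrite mulrC -ler_pdivlMr// ge_min lexx orbT.
have Fr' v : euclidean_dist (f x) v < e -> mdist (S x) (S (F v)) < r'.
  by move=> /Fe xv; rewrite Sk; apply: lt_le_trans ker; rewrite ltr_pM2l.
exists e, F; split=> //.
- apply/esym/mdist_positivity; have [|xF FE] := FP (f x).
    by rewrite fr// mdistxx.
  by rewrite -fr// FE fr// mdistxx.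
- move=> u v xu xv; have [xFu fu] := FP _ xu; have [xFv fv] := FP _ xv.
  by rewrite fr' ?Fr'// Sk -[in LHS]fr// fu fv.
Qed.

Lemma euclidean_at_dim m m' x : euclidean_at m x -> euclidean_at m' x -> (m <= m')%N.
Proof.
move=> /euclidean_at_ball[r r0 [f Ef]] /euclidean_at_ball[r' r'0 [f' Ef']].
have [|e [F [e0 _ _ _ gE]]] := similitude_chart (S := id) ltr01 _ r0 r'0 Ef Ef'.
  by move=> y z; rewrite mul1r.
exact: (scaled_isometry_dim ltr01 e0 gE).
Qed.

Section connected.
Hypotheses (M_connected : connected_space) (M_euclidean : locally_euclidean M).

(** The points of each dimension form an open set and these sets are disjoint, so each of them is
    clopen. *)
Lemma euclidean_at_constant (x0 : M) : exists m, forall x, euclidean_at m x.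
Proof.
have [m m0] := M_euclidean x0; exists m => x.
have open_at j : open [set y | euclidean_at j y].
  rewrite openE => y [U [f [oU Uy ofU fU]]].
  apply: filterS (open_nbhs_nbhs (conj oU Uy)) => z Uz.
  by exists U, f.
suff : [set y | euclidean_at m y] = setT by move=> /seteqP[_ /(_ x)]; exact.
apply: M_connected => //; last by exists x0.
rewrite (_ : ~` _ = \bigcup_(j in [set j | j != m]) [set y | euclidean_at j y]).
  by apply: bigcup_open => j _; exact: open_at.
apply/seteqP; split=> y /=.
  move=> ny; have [j jy] := M_euclidean y; exists j => //=.
  by apply/eqP => jm; apply: ny; rewrite -jm.
move=> [j /= jm jy] my; move/eqP: jm; apply; apply/eqP.
by rewrite eqn_leq (euclidean_at_dim jy my) (euclidean_at_dim my jy).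
Qed.

Lemma similitude_surjective (S : M -> M) (k : R) : complete_metric M -> 0 < k ->
  (forall y z, mdist (S y) (S z) = k * mdist y z) -> forall y, exists x, S x = y.
Proof.
move=> M_complete k0 Sk y.
have [m m_at] := euclidean_at_constant y.
suff : range S = setT by move=> /seteqP[_ /(_ y)] [//|x _ <-]; exists x.
apply: M_connected; last by exists (S y), y.
  apply/open_mdist => _ [x _ <-].
  have [r r0 [f Ef]] := euclidean_at_ball (m_at x).
  have [r' r'0 [f' Ef']] := euclidean_at_ball (m_at (S x)).
  have [e [F [e0 ker Fx Fe gE]]] := similitude_chart k0 Sk r0 r'0 Ef Ef'.
  exists (k * e); first exact: mulr_gt0.
  move=> z xz; have [v xv vz] : exists2 v, euclidean_dist (f x) v < e &
      f' (S (F v)) = f' z.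
    apply: (scaled_isometry_onto k0 e0 gE) => //.
    by rewrite Fx (proj1 Ef')// ?mdistxx// (lt_le_trans xz).
  exists (F v) => //; apply: mdist_positivity.
  rewrite -(proj1 Ef') ?(lt_le_trans xz)//.
    by rewrite vz (proj1 Ef') ?mdistxx// (lt_le_trans xz).
  by rewrite Sk; apply: lt_le_trans ker; rewrite ltr_pM2l// Fe.
rewrite openC; move=> z clz.
(* For [z] in the closure of the range, the preimages of small balls around [z] form a Cauchy
   filter, the inverse of [S] being Lipschitz; its limit is sent to [z]. *)
pose P (e : R) := [set x | mdist z (S x) < e].
have PP e : 0 < e -> P e !=set0.
  move=> e0; have /clz[_ [[x _ <-] xe]] : nbhs z [set w | mdist z w < e].
    by apply/nbhs_mdist; exists e.
  by exists x.
pose F := filter_from [set e : R | 0 < e] P.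
have FF : ProperFilter F.
  apply: filter_from_proper; last by move=> e; exact: PP.
  apply: filter_from_filter; first by exists 1 => /=.
  move=> a b a0 b0; exists (Num.min a b); first by rewrite /= lt_min a0.
  by move=> x; rewrite /P /= lt_min => /andP[].
have [x Fx] : exists x : M, F --> x.
  apply: M_complete; apply: cauchy_exP => e e0.
  have ke0 : 0 < k * e / 2 by rewrite divr_gt0 ?mulr_gt0.
  have [x xP] := PP _ ke0; exists x, (k * e / 2) => //= w wP.
  rewrite ballEmdist /= -(ltr_pM2l k0) -Sk [ltRHS]splitr.
  by apply: le_lt_trans (metric_triangle _ z _) _; rewrite ltrD// metric_sym.
exists x => //; apply/esym/mdist_positivity.
apply/eqP; rewrite eq_le mdist_ge0 andbT; apply/ler_addgt0Pl => e e0.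
have ke0 : 0 < e / 2 / k by rewrite !divr_gt0.
have /Fx[a /= a0 aP] : nbhs x [set w | mdist x w < e / 2 / k].
  by apply/nbhs_mdist; exists (e / 2 / k).
have [|w] := PP (Num.min a (e / 2)); first by rewrite lt_min a0 divr_gt0.
rewrite /P /= lt_min => /andP[wa we].
rewrite addr0 [leRHS]splitr; apply: le_trans (metric_triangle _ (S w) _) _.
rewrite lerD ?(ltW we)// Sk metric_sym mulrC -ler_pdivlMr//.
by apply/ltW/aP; rewrite /P /=.
Qed.

End connected.
End Manifold.

(** Cubes of side [d * r], indexed by truncated coordinates that are first shifted to be
    nonnegative. [I] depends neither on [x] nor on [r]. The denominator [m.+1] covers [m = 0] and
    makes the last inequality strict. *)
Lemma euclidean_grid (R : realType) (m : nat) (C c : R) : 0 < C -> 0 < c ->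
  exists I : finType, forall (x : 'rV[R]_m) (r : R), 0 < r ->
  exists cell : 'rV[R]_m -> I, forall a b,
    euclidean_dist x a < C * r -> euclidean_dist x b < C * r -> cell a = cell b ->
    euclidean_dist a b < c * r.
Proof.
move=> C0 c0; pose d := c / m.+1%:R; have d0 : 0 < d by rewrite divr_gt0.
pose L := (Num.truncn (C / d)).+1; pose D := Num.truncn (2 * L%:R : R).
exists {ffun 'I_m -> 'I_D.+1} => x r r0; have dr0 : 0 < d * r by rewrite mulr_gt0.
pose t (a : 'rV[R]_m) i := (a 0 i - x 0 i) / (d * r) + L%:R.
exists (fun a => [ffun i => inord (Num.truncn (t a i))]) => a b xa xb ab.
have tP y i : euclidean_dist x y < C * r -> 0 <= t y i <= 2 * L%:R.
  move=> xy; have : `|(y 0 i - x 0 i) / (d * r)| <= L%:R.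
    rewrite normrM normfV (gtr0_norm dr0) ler_pdivrMr//.
    apply: le_trans (ler_euclidean_dist _ _ _) _; rewrite euclidean_dist_sym.
    apply: le_trans (ltW xy) _; rewrite mulrA ler_pM2r// -ler_pdivrMr//.
    by apply/ltW; rewrite /L truncnS_gt.
  by rewrite ler_norml /t => /andP[? ?]; apply/andP; split; lra.
have tD y i : euclidean_dist x y < C * r -> (Num.truncn (t y i) < D.+1)%N.
  by move=> /tP-/(_ i)/andP[_ tL]; rewrite ltnS /D le_truncn.
have close i : `|a 0 i - b 0 i| < d * r.
  move/ffunP/(_ i): ab; rewrite !ffunE => /(congr1 val) /=.
  rewrite !inordK ?tD// => E.
  have /andP[a0 _] := tP _ i xa; have /andP[b0 _] := tP _ i xb.
  have /andP[a1 a2] := truncn_itv a0; have /andP[b1 b2] := truncn_itv b0.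
  have : `|t a i - t b i| < 1.
    rewrite -natr1 in a2; rewrite -natr1 in b2.
    rewrite -E in b1 b2; rewrite ltr_norml; apply/andP; split; lra.
  rewrite /t opprD addrACA subrr addr0 -mulrBl opprB addrA subrK.
  by rewrite normrM normfV (gtr0_norm dr0) ltr_pdivrMr// mul1r.
have cr0 : 0 < c * r by rewrite mulr_gt0.
rewrite -(@ltr_pXn2r _ 2) ?nnegrE ?sqrtr_ge0 ?(ltW cr0)// sqr_euclidean_dist dotpE.
apply: (@le_lt_trans _ _ (\sum_(i < m) (d * r) ^+ 2)).
  apply: ler_sum => i _; rewrite -expr2 !mxE -real_normK ?num_real//.
  by rewrite ler_pXn2r ?nnegrE// ltW.
have -> : c * r = m.+1%:R * (d * r) by rewrite mulrA [_ * d]mulrC divfK ?pnatr_eq0.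
rewrite big_const_ord iter_addr_0 [ltRHS]exprMn -[ltLHS]mulr_natl.
rewrite -natrX ltr_pM2r ?exprn_gt0// ltr_nat expnS expn1 mulSn addSn ltnS.
by rewrite (leq_trans _ (leq_addr _ _)).
Qed.

(** [I] is fixed before [S], [K] and [x], the Euclidean grid being independent of scale. The chart
    is taken at a cluster point of the orbit of [x], and the cells are pulled back by an iterate of
    [S]. *)
Lemma compact_grid (R : realType) (M : metricType R) (m : nat) (C c : R) :
  0 < C -> 0 < c -> (forall x : M, euclidean_at m x) ->
  exists I : finType, forall (S : M -> M) (k : R) (K : set M),
  0 < k < 1 -> (forall y z, mdist (S y) (S z) = k * mdist y z) ->
  compact K -> S @` K `<=` K -> forall x r, K x -> 0 < r ->
  exists cell : M -> I, forall a b,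
    mdist x a < C * r -> mdist x b < C * r -> cell a = cell b ->
    mdist a b < c * r.
Proof.
move=> C0 c0 M_at; have [I HI] := euclidean_grid m C0 c0.
exists I => S k K /andP[k0 k1] Sk cK SK x r Kx r0.
have iterS j y z : mdist (iter j S y) (iter j S z) = k ^+ j * mdist y z.
  by elim: j => [|j IH] /=; rewrite ?mul1r// Sk IH exprS mulrA.
have iterK j : K (iter j S x).
  by elim: j => //= j IH; apply: SK; exists (iter j S x).
have [|z [Kz clz]] := cK (iter j S x @[j --> \oo]) _.
  by exists 0%N => // j _; exact: iterK.
have [e e0 [f [fe _]]] := euclidean_at_ball (M_at z).
have Cr0 : 0 < C * r by rewrite mulr_gt0.
have : k ^+ j @[j --> \oo] --> (0 : R).
  by apply: cvg_expr; rewrite gtr0_norm.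
move=> /cvgrPdist_lt/(_ (e / 2 / (C * r))).
have ce0 : 0 < e / 2 / (C * r) by rewrite !divr_gt0.
move=> /(_ ce0)[j0 _ Hj0].
have [||_ [[j jj0 <-] zj]] := clz [set iter j S x | j in [set j | (j0 <= j)%N]]
    [set w | mdist z w < e / 2].
- by exists j0 => // j /= jj0; exists j.
- by apply: (proj2 (nbhs_mdist z _)); exists (e / 2); rewrite ?divr_gt0.
have kj0 : 0 < k ^+ j by rewrite exprn_gt0.
have kj : k ^+ j * (C * r) < e / 2.
  by have := Hj0 j jj0; rewrite /= sub0r normrN gtr0_norm// ltr_pdivlMr.
have near a : mdist x a < C * r -> mdist z (iter j S a) < e.
  move=> xa; rewrite [ltRHS]splitr; apply: le_lt_trans (metric_triangle _ (iter j S x) _) _.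
  by rewrite ltrD// iterS; apply: lt_trans kj; rewrite ltr_pM2l.
have zx : mdist z (iter j S x) < e by apply: near; rewrite mdistxx.
have [|cell Hcell] := HI (f (iter j S x)) (k ^+ j * r); first by rewrite mulr_gt0.
exists (cell \o f \o iter j S) => a b xa xb ab.
have := fun h1 h2 => Hcell (f (iter j S a)) (f (iter j S b)) h1 h2 ab.
rewrite !fe ?zx ?(near a) ?(near b)// !iterS.
by rewrite ![_ * (k ^+ j * r)]mulrCA !ltr_pM2l//; apply.
Qed.

(** * Paths, vertices and the reduced graph *)

(** A point of [A] turns [T] into a pointed space, to which [compact_cover] applies. *)
Lemma compact_cover_nonempty (T : topologicalType) (A : set T) :
  A !=set0 -> compact A -> cover_compact A.
Proof.
move=> [x _]; pose T' : ptopologicalType := HB.pack T (isPointed.Build T x).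
have := @compact_cover T' => /(congr1 (@^~ A)) /= E cA.
have : @cover_compact T' A by rewrite -E.
exact.
Qed.

Section Paths.
Variables (R : realType) (M : metricType R) (d : Order.disp_t) (G : gifs M d).
Local Notation V := 'I_(nvert G).
Local Notation E := (gedge G).
Implicit Types (p s : seq E) (i : V).

Lemma path_map_cat p s : Defs.path_map (p ++ s) = Defs.path_map p \o Defs.path_map s.
Proof. by elim: p => //= e p ->. Qed.

Lemma path_ratio_nil : path_ratio ([::] : seq E) = 1.
Proof. by rewrite /path_ratio big_nil. Qed.

Lemma path_ratio_cons e p : path_ratio (e :: p) = Defs.ratio e * path_ratio p.
Proof. by rewrite /path_ratio big_cons. Qed.

Lemma path_ratio_gt0 p : 0 < path_ratio p.
Proof. by apply: prodr_gt0 => e _; have /andP[] := ratio_bounds e. Qed.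

Lemma path_mapE p x y : mdist (Defs.path_map p x) (Defs.path_map p y) = path_ratio p * mdist x y.
Proof.
elim: p => [|e p IH]; first by rewrite path_ratio_nil mul1r.
by rewrite path_ratio_cons /= smap_similitude IH mulrA.
Qed.

Lemma path_ratio_exp : exists2 k : R, 0 < k < 1 & forall p, path_ratio p <= k ^+ size p.
Proof.
have [k /andP[k0 k1] Hk] : exists2 k : R, 2^-1 < k < 1 & forall e : E, Defs.ratio e <= k.
  apply: finite_lt_bound; first by lra.
  by move=> e; have /andP[] := ratio_bounds e.
have k00 : 0 < k by lra.
exists k; first by rewrite k00.
elim=> [|e p IH]; first by rewrite path_ratio_nil.
have /andP[e0 _] := ratio_bounds e.
rewrite path_ratio_cons exprS ler_pM// ?ltW//; exact: path_ratio_gt0.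
Qed.

Lemma path_ratio_le1 p : path_ratio p <= 1.
Proof.
have [k /andP[k0 k1] /(_ p)/le_trans] := path_ratio_exp; apply.
by rewrite exprn_ile1// ltW.
Qed.

Lemma dterm_cat i p s : dterm (i, p ++ s) = dterm (dterm (i, p), s) :> V.
Proof. by rewrite /dterm /= map_cat last_cat. Qed.

Lemma walk_cat i p s : walk i (p ++ s) = walk i p && walk (dterm (i, p)) s.
Proof.
elim: p i => //= e p IH i; rewrite IH andbA.
by rewrite /dterm.
Qed.

Section attractor.
Variable K : V -> set M.
Hypothesis K_self_similar : self_similar_family K.

Lemma path_map_attractor i p : walk i p -> Defs.path_map p @` K (dterm (i, p)) `<=` K i.
Proof.
elim: p i => [|e p IH] i; first by move=> _ _ [x Kx <-].
move=> /= /andP[/eqP ei wp] _ [x Kx <-].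
rewrite (proj2 K_self_similar i); exists e => //=.
by exists (Defs.path_map p x) => //; apply: (IH _ wp); exists x.
Qed.

Lemma attractor_path n i x : K i x ->
  exists p, [/\ walk i p, size p = n & (Defs.path_map p @` K (dterm (i, p))) x].
Proof.
elim: n i x => [|n IH] i x Kx; first by exists [::]; split=> //; exists x.
move: Kx; rewrite (proj2 K_self_similar i) => -[e /= ei [y /IH[p [wp sp [z Kz zy]]] <-]].
exists (e :: p); split => /=; first by rewrite ei eqxx.
  by rewrite sp.
by exists z => //=; rewrite zy.
Qed.

Lemma attractor_bounded : exists2 D : R, 0 < D &
  forall i x y, K i x -> K i y -> mdist x y <= D.
Proof.
have bK i : exists D : R, forall x y, K i x -> K i y -> mdist x y <= D.
  have [[x0 Kx0] cK] := proj1 K_self_similar i.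
  have := compact_cover_nonempty (ex_intro _ x0 Kx0) cK.
  move=> /(_ nat setT (fun j => [set y | mdist x0 y < j%:R])).
  case=> [j _|y _|D _ KD].
  - apply/open_mdist => y /= yj; exists (j%:R - mdist x0 y); first by rewrite subr_gt0.
    by move=> z yz; rewrite (le_lt_trans (metric_triangle _ y _))// -ltrBrDl.
  - exists (Num.truncn (mdist x0 y)).+1 => //=.
    by have /andP[] := truncn_itv (mdist_ge0 x0 y).
  - pose j := (\max_(l <- D) l)%N.
    have Kj y : K i y -> mdist x0 y < j%:R.
      move=> /KD[l /= lD] /lt_le_trans; apply; rewrite ler_nat.
      exact: leq_bigmax_seq.
    exists (j%:R + j%:R) => y z /Kj xy /Kj xz.
    by rewrite (le_trans (metric_triangle _ x0 _))// lerD ?ltW// metric_sym.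
have [D D0 HD] := finite_bound (fun i => projT1 (cid (bK i))) 0.
exists D => // i x y Kx Ky; apply: le_trans (ltW (HD i)).
exact: (projT2 (cid (bK i))).
Qed.
End attractor.
End Paths.

(** * Pruned edges, removed vertices, and the cells that cover the attractor *)

Section ReducedGraph.
Variables (R : realType) (M : metricType R) (d : Order.disp_t) (G : gifs M d).
Local Notation V := 'I_(nvert G).
Local Notation E := (gedge G).
Variables (Omega : V -> set M) (F : nat -> {fset dpath G}) (a b : M).
Hypothesis ab : a != b.
Hypothesis smap_surj : forall (e : E) y, exists x, smap e x = y.
Hypothesis FN : nested_index_sets F.
Implicit Types (w : vertex G) (p : seq E) (u v : dpath G).

(** A vertex stores a map and not a path, so its ratio is read off the images of two distinct
    points; paths with the same map get the same ratio. *)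
Definition vratio w : R := mdist (vmap w a) (vmap w b) / mdist a b.

(** The only vertex that an edge labelled [p] from [w] can reach. *)
Definition child w p : vertex G :=
  Vertex (vmap w \o Defs.path_map p) (vini w) (dterm (vter w, p)) (vlev w).+1.

Let ab0 : 0 < mdist a b. Proof. by rewrite mdist_gt0. Qed.

Lemma vratio_path k u : vratio (vertex_of k u) = path_ratio u.2.
Proof. by rewrite /vratio path_mapE mulfK// gt_eqF. Qed.

Lemma vratioE w : vratio w = mdist (vmap w a) (vmap w b) / mdist a b.
Proof. by []. Qed.

Lemma vratio_eq w w' : vmap w = vmap w' -> vratio w = vratio w'.
Proof. by rewrite /vratio => ->. Qed.

Lemma vertexP w : is_vertex F w -> exists u,
  [/\ u \in F (vlev w), w = vertex_of (vlev w) u & is_dpath u].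
Proof.
move=> [u uF ->]; exists u; split=> //.
case: (vlev w) uF => [|k]; last by move=> /(nis_Estar FN (ltn0Sn k))[].
by rewrite (nis_zero FN) /is_dpath => /eqP ->.
Qed.

Lemma vratio_gt0 w : is_vertex F w -> 0 < vratio w.
Proof. by move=> [u _ ->]; rewrite vratio_path path_ratio_gt0. Qed.

Lemma vmapE w x y : is_vertex F w ->
  mdist (vmap w x) (vmap w y) = vratio w * mdist x y.
Proof. by move=> [u _ ->]; rewrite vratio_path /= path_mapE. Qed.

Lemma path_map_surj p y : exists x, Defs.path_map p x = y.
Proof.
elim: p y => [|e p IH] y; first by exists y.
by have [z <-] := smap_surj e y; have [x <-] := IH z; exists x.
Qed.

Lemma vmap_surj w y : is_vertex F w -> exists x, vmap w x = y.
Proof. by move=> [u _ ->]; exact: path_map_surj. Qed.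

Lemma vratio_child w p : is_vertex F w ->
  vratio (child w p) = vratio w * path_ratio p.
Proof.
by move=> wF; rewrite {1}/vratio /= vmapE// path_mapE mulrA mulfK// gt_eqF.
Qed.

Lemma gedge_toP w p w' : gedge_to F w p w' ->
  [/\ w' = child w p, is_vertex F w, is_vertex F w' & walk (vter w) p].
Proof.
move=> [u [v [uF vF wE wE' vE]]].
have wF : is_vertex F w by exists u.
have wF' : is_vertex F w' by exists v => //; rewrite wE'.
have [v' [v'F _ _]] := vertexP wF'.
have vD : is_dpath v by case: (nis_Estar FN (ltn0Sn _) vF).
split=> //.
- by rewrite wE' {2}wE vE /child /vertex_of /= path_map_cat dterm_cat.
- by move: vD; rewrite vE /is_dpath /= walk_cat wE => /andP[].
Qed.

(** Minimality makes the labels equal, and the common map [path_map p1] is onto, hence cancels on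
    the right. The terminal vertices of [w1] and [w2] agree because they start the label, or are
    kept by an empty one. *)
Lemma pruned_edge_uniq w1 p1 w2 p2 w' :
  pruned_edge F w1 p1 w' -> pruned_edge F w2 p2 w' -> w1 = w2 /\ p1 = p2.
Proof.
move=> [g1 min1] [g2 min2]; have p12 : p1 = p2.
  by apply: (@le_anti _ (seqlexi E)); rewrite (min1 _ _ g2) (min2 _ _ g1).
split=> //; move: g1 g2; rewrite -p12.
move=> /gedge_toP[w1E w1F _ wk1] /gedge_toP[+ w2F _ wk2].
rewrite w1E /child.
case: w1 w1E w1F wk1 {min1} => f1 i1 j1 k1 _ w1F wk1.
case: w2 w2F wk2 {min2} => f2 i2 j2 k2 w2F wk2 [] /= fE <- jE <-.
have f12 : f1 = f2.
  apply/funext => y; have [x <-] := path_map_surj p1 y.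
  by have := congr1 (@^~ x) fE.
suff : j1 = j2 by rewrite f12 => ->.
by case: p1 {p12 fE} wk1 wk2 jE => //= e p /andP[/eqP <- _] /andP[/eqP <- _].
Qed.

Lemma vertex_parent w' k : is_vertex F w' -> vlev w' = k.+1 ->
  exists w p, gedge_to F w p w'.
Proof.
move=> [v vF vE] kE; rewrite kE in vF vE.
have [u uF /andP[/eqP uv /prefixP[p pE]]] : exists2 u, u \in F k & dprefix u v.
  case: k {kE vE} vF => [|k] vF; last exact: (nis_refine FN).
  by exists (v.1, [::]); rewrite ?(nis_zero FN)// /dprefix /= eqxx prefix0s.
exists (vertex_of k u), p, u, v; split=> //=.
by case: v uv pE {vF vE} => v1 v2 /= <- ->.
Qed.

Lemma gedge_label_finite k :
  finite_set [set p | exists w w', vlev w = k /\ gedge_to F w p w'].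
Proof.
apply: (@sub_finite_set _ _ ((fun uv : dpath G * dpath G =>
    drop (size uv.1.2) uv.2.2) @` ([set` F k] `*` [set` F k.+1]))).
  move=> p [w [w' [<- [u [v [uF vF _ _ vE]]]]]]; exists (u, v) => //=.
  by move: vE => ->; rewrite /= drop_size_cat.
by apply: finite_image; apply: finite_setX; exact: finite_fset.
Qed.

(** The lexicographic order on words need not be well-founded; the least label is found in a finite
    set. *)
Lemma vertex_pruned w' k : is_vertex F w' -> vlev w' = k.+1 ->
  exists w p, pruned_edge F w p w'.
Proof.
move=> w'F w'k; have [w0 [p0 g0]] := vertex_parent w'F w'k.
pose P : set (seqlexi E) := [set p | exists w, gedge_to F w p w'].
have /finite_seqP[s sE] : finite_set P.
  apply: sub_finite_set (gedge_label_finite k) => p [w g].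
  exists w, w'; split=> //.
  by have [w'E _ _ _] := gedge_toP g; move: w'k; rewrite w'E => -[].
suff [p [w g] pmin] : exists2 p, P p & forall r, P r -> (p <= r)%O.
  by exists w, p; split=> // w2 p2 g2; apply: pmin; exists w2.
have : P p0 by exists w0.
rewrite {}sE; elim: s p0 {g0} => // q s IH p0 _.
case: s IH => [_|r s IH]; first by exists q => [|r]; rewrite /= inE => // /eqP ->.
have [p ps pmin] := IH r (mem_head r s).
have [qp|/ltW pq] := leP q p.
  exists q => [|t]; rewrite /= inE ?eqxx// => /orP[/eqP ->//|ts].
  by apply: le_trans qp _; exact: pmin.
exists p => [|t]; rewrite /= inE; first by apply/orP; right.
by move=> /orP[/eqP ->//|]; exact: pmin.
Qed.

(** Attaches a number to [removed]: no pruned chain below the vertex has more than [n] edges. *)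
Inductive height_le : nat -> vertex G -> Prop :=
| HeightLe n w : (forall p w', pruned_edge F w p w' ->
    exists2 m, (m < n)%N & height_le m w') -> height_le n w.

Lemma height_leW n m w : (n <= m)%N -> height_le n w -> height_le m w.
Proof.
move=> nm h; case: h nm => {}n {}w H nm; constructor=> p w' /H[l ln hl].
by exists l => //; exact: leq_trans nm.
Qed.

Lemma pruned_gedge w p w' : pruned_edge F w p w' -> gedge_to F w p w'.
Proof. by case. Qed.

(* Koenig's lemma: the pruned graph is finitely branching. *)
Lemma removed_height w : removed F w -> exists n, height_le n w.
Proof.
move=> r; elim: r => {}w _ IH.
have /finite_seqP[s sE] := gedge_label_finite (vlev w).
pose m p := if pselect (exists n, height_le n (child w p)) is left H
  then projT1 (cid H) else 0%N.
exists (\max_(p <- s) m p).+1; constructor=> p w' pe.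
have [w'E _ _ _] := gedge_toP (pruned_gedge pe).
exists (m p).
  rewrite ltnS; apply: leq_bigmax_seq => //.
  have : [set` s] p by rewrite -sE; exists w, w'; split=> //; exact: pruned_gedge.
  by [].
have hw := IH _ _ pe; rewrite w'E in hw *.
by rewrite /m; case: pselect => // H; exact: (projT2 (cid H)).
Qed.

Section attractor.
Variable K : V -> set M.
Hypothesis K_self_similar : self_similar_family K.

Definition vcell w : set M := vmap w @` K (vter w).

Lemma vcell_child w p : walk (vter w) p -> vcell (child w p) `<=` vcell w.
Proof.
move=> wp _ [x Kx <-]; exists (Defs.path_map p x) => //.
by apply: (path_map_attractor K_self_similar wp); exists x.
Qed.

Lemma vcell_attractor w : is_vertex F w -> vcell w `<=` K (vini w).
Proof.
move=> /vertexP[u [_ wE uD]]; rewrite wE /vcell /=.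
by apply: path_map_attractor => //; case: u uD {wE}.
Qed.

Lemma attractor_vertex k i x : K i x ->
  exists w, [/\ is_vertex F w, vlev w = k, vini w = i & vcell w x].
Proof.
case: k => [|k] Kx.
  exists (vertex_of 0 (i, [::])); split=> //; last by exists x.
  by exists (i, [::]) => //=; rewrite (nis_zero FN).
have [p [wp sp [z Kz zx]]] := attractor_path K_self_similar (maxlen (F k.+1)).+1 Kx.
have [||[u1 u2] uF /andP[/= /eqP uE /prefixP[s psE]]] := nis_long FN (ltn0Sn k) (v := (i, p)).
- by split; rewrite /dlen /= ?sp.
- by rewrite /dlen /= sp.
subst u1 p; exists (vertex_of k.+1 (i, u2)); split=> //.
  by exists (i, u2).
move: wp Kz zx; rewrite walk_cat dterm_cat path_map_cat => /andP[_ ws] Kz /= zx.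
exists (Defs.path_map s z) => //.
by apply: (path_map_attractor K_self_similar ws); exists z.
Qed.

(** Each step up the pruned graph keeps [x] in the cell and raises the lower bound [h] on the height
    by one. *)
Lemma vertex_ancestor k n h w x : is_vertex F w -> vlev w = (k + n)%N ->
  vcell w x -> (forall m, height_le m w -> (h <= m)%N) ->
  exists w', [/\ is_vertex F w', vlev w' = k, vini w' = vini w, vcell w' x &
    forall m, height_le m w' -> (n + h <= m)%N].
Proof.
elim: n h w => [|n IH] h w wF wk wx H; first by exists w; rewrite addn0 in wk.
rewrite addnS in wk; have [w1 [p pe]] := vertex_pruned wF wk.
have [wE w1F _ wp] := gedge_toP (pruned_gedge pe).
have [||m hm|w' [w'F w'k w'i w'x Hw']] := IH h.+1 w1 w1F.
- by move: wk; rewrite wE => -[].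
- by apply: (vcell_child wp); rewrite -wE.
- by case: hm pe {wE w1F wp} => m1 w2 Hm /Hm[l lm /H hl]; exact: leq_ltn_trans lm.
- by exists w'; split=> //; rewrite ?addSnnS// w'i wE.
Qed.

(** If all cells of level [k] at [x] had finite height, finitely many vertices would share a bound
    [N]; but a cell of level [k + N.+1] at [x] has an ancestor of level [k] whose height exceeds
    [N]. *)
Lemma attractor_reduced k i x : K i x ->
  exists w, [/\ reduced_vertex F w, vlev w = k, vini w = i & vcell w x].
Proof.
move=> Kx; apply: contrapT => H.
have Hrem w : is_vertex F w -> vlev w = k -> vini w = i -> vcell w x ->
    exists n, height_le n w.
  move=> wF wk wi wx; apply: removed_height; apply: contrapT => nr.
  by apply: H; exists w.
have [N HN] : exists N, forall w, is_vertex F w -> vlev w = k -> vini w = i ->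
    vcell w x -> height_le N w.
  pose m u := if pselect (exists n, height_le n (vertex_of k u)) is left H
    then projT1 (cid H) else 0%N.
  exists (\max_(u <- F k) m u)%N => w wF wk wi wx.
  have [u uF wE] := wF; rewrite wk in uF wE.
  apply: (@height_leW (m u)); first exact: leq_bigmax_seq.
  have := Hrem _ wF wk wi wx; rewrite wE /m.
  by case: pselect => // H' _; exact: (projT2 (cid H')).
have [w [wF wk wi wx]] := attractor_vertex (k + N.+1) Kx.
have [//|w' [w'F w'k w'i w'x Hw']] := @vertex_ancestor k N.+1 0 w x wF wk wx.
have := Hw' _ (HN _ w'F w'k (etrans w'i wi) w'x).
by rewrite addn0 ltnn.
Qed.

Lemma reduced_child w : reduced_vertex F w ->
  exists p, reduced_edge F w p (child w p).
Proof.
move=> wR; have [wF nw] := wR; apply: contrapT => H; apply: nw; constructor.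
move=> p w' pe; apply: contrapT => nw'; apply: H; exists p.
have [wE _ w'F _] := gedge_toP (pruned_gedge pe).
by rewrite -wE; split.
Qed.

Lemma reduced_parent w k : reduced_vertex F w -> vlev w = k.+1 ->
  exists w1 p, reduced_edge F w1 p w.
Proof.
move=> wR wk; have [wF nw] := wR; have [w1 [p pe]] := vertex_pruned wF wk.
exists w1, p; have [wE w1F _ wp] := gedge_toP (pruned_gedge pe).
split=> //; split=> // r; apply: nw.
by case: r pe {wE w1F wp} => w2 H2; exact: H2.
Qed.

End attractor.

End ReducedGraph.

(** * Nodes of the reduced forest and neighborhood types *)

Lemma size_le_code (T J : eqType) (s : seq T) (t : seq J) (P : T -> J -> Prop) :
  uniq s -> (forall x, x \in s -> exists2 j, j \in t & P x j) ->
  (forall x y j, x \in s -> y \in s -> P x j -> P y j -> x = y) ->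
  (size s <= size t)%N.
Proof.
case: s => // x0 s' us sP Pinj; set s := x0 :: s' in us sP Pinj *.
have [j0 _ _] := sP x0 (mem_head _ _).
pose f x := if pselect (exists2 j, j \in t & P x j) is left H
  then projT1 (cid2 H) else j0.
have fP x : x \in s -> f x \in t /\ P x (f x).
  move=> xs; rewrite /f; case: pselect => [H|/(_ (sP x xs))//].
  by case: (cid2 H).
rewrite -(size_map f) uniq_leq_size ?map_inj_in_uniq//.
  move=> x y xs ys fxy; have [_ Px] := fP x xs; have [_ Py] := fP y ys.
  by apply: Pinj Px _ => //; rewrite fxy.
by move=> _ /mapP[x xs ->]; have [] := fP x xs.
Qed.

Fixpoint words (T : eqType) (s : seq T) (n : nat) : seq (seq T) :=
  if n is n'.+1 then [::] :: [seq x :: y | x <- s, y <- words s n'] else [:: [::]].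

Lemma mem_words (T : eqType) (s : seq T) n (y : seq T) :
  (size y <= n)%N -> {subset y <= s} -> y \in words s n.
Proof.
elim: n y => [|n IH] [|x y] //= yn ys; rewrite inE /=.
apply/allpairsP; exists (x, y); split=> //=; first by apply: ys; rewrite mem_head.
by apply: IH => // z zy; apply: ys; rewrite inE zy orbT.
Qed.

Section Tree.
Variables (R : realType) (M : metricType R) (d : Order.disp_t) (G : gifs M d).
Local Notation V := 'I_(nvert G).
Local Notation E := (gedge G).
Variables (Omega : V -> set M) (F : nat -> {fset dpath G}) (a b : M).
Hypothesis ab : a != b.
Hypothesis smap_surj : forall (e : E) y, exists x, smap e x = y.
Hypothesis FN : nested_index_sets F.
Implicit Types (w : vertex G) (p : seq E) (z y : seq (seq E)).
Local Notation vratio := (vratio a b).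

Definition labels w : seq (seq E) :=
  enum_fset (fset_set [set p | reduced_edge F w p (child w p)]).

Lemma mem_labels w p : p \in labels w <-> reduced_edge F w p (child w p).
Proof.
rewrite /labels in_fset_set.
  by split => [/set_mem//|/mem_set].
apply: sub_finite_set (gedge_label_finite F (vlev w)) => q [/pruned_gedge g _ _].
by exists w, (child w q).
Qed.

Lemma reduced_edgeE w p w' : reduced_edge F w p w' -> w' = child w p.
Proof. by move=> [/pruned_gedge/(gedge_toP FN)[]]. Qed.

(** Nodes below a vertex are addressed by lists of labels, so that ancestors are prefixes and cuts
    are lists of addresses. *)
Definition descend : vertex G -> seq (seq E) -> vertex G := foldl (@child _ _ _ G).

Fixpoint is_node w z : bool :=
  if z is p :: z' then (p \in labels w) && is_node (child w p) z' else true.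

Lemma is_node_cat w z y : is_node w (z ++ y) = is_node w z && is_node (descend w z) y.
Proof. by elim: z w => //= p z IH w; rewrite IH andbA. Qed.

Lemma descend_cat w z y : descend w (z ++ y) = descend (descend w z) y.
Proof. exact: foldl_cat. Qed.

Lemma descend_rcons w z p : descend w (rcons z p) = child (descend w z) p.
Proof. by rewrite -cats1 descend_cat. Qed.

Lemma is_node_rcons w z p :
  is_node w (rcons z p) = is_node w z && (p \in labels (descend w z)).
Proof. by rewrite -cats1 is_node_cat /= andbT. Qed.

Lemma descend_reduced w z : reduced_vertex F w -> is_node w z ->
  reduced_vertex F (descend w z).
Proof. by elim: z w => //= p z IH w _ /andP[/mem_labels[_ _ cR] ?]; exact: IH. Qed.

Lemma vlev_descend w z : vlev (descend w z) = (vlev w + size z)%N.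
Proof. by elim: z w => [|p z IH] w /=; rewrite ?addn0// IH /= addSnnS. Qed.

Lemma vini_descend w z : vini (descend w z) = vini w.
Proof. by elim: z w => //= p z IH w; rewrite IH. Qed.

Lemma descend_inj w z y : is_node w z -> is_node w y ->
  descend w z = descend w y -> z = y.
Proof.
move=> + + zy; have : size z = size y.
  by have := congr1 (@vlev _ _ _ G) zy; rewrite !vlev_descend => /addnI.
elim/last_ind: z y zy => [|z p IH] y; first by case: y.
case/lastP: y => [|y s]; first by rewrite size_rcons.
rewrite !size_rcons !is_node_rcons !descend_rcons => zy [szy].
move=> /andP[nz /mem_labels[pz _ _]] /andP[ny /mem_labels[py _ _]].
rewrite zy in pz; have [dzy ->] := pruned_edge_uniq smap_surj FN pz py.
by rewrite (IH _ dzy).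
Qed.

Lemma labels_walk w p : p \in labels w -> walk (vter w) p.
Proof. by move=> /mem_labels[/pruned_gedge/(gedge_toP FN)[]]. Qed.

Lemma vcell_descend (K : V -> set M) w z : self_similar_family K -> is_node w z ->
  vcell K (descend w z) `<=` vcell K w.
Proof.
move=> KS; elim: z w => [|p z IH] w /=; first by move=> _; exact: subset_refl.
move=> /andP[pl nz].
by apply: subset_trans (IH _ nz) _; exact: (vcell_child KS (labels_walk pl)).
Qed.

Lemma path_map_invariant i p : invariant_family Omega -> walk i p ->
  Defs.path_map p @` Omega (dterm (i, p)) `<=` Omega i.
Proof.
move=> OI; elim: p i => [|e p IH] i; first by move=> _ _ [x Ox <-].
move=> /= /andP[/eqP ei wp] _ [x Ox <-]; rewrite -ei.
apply: (proj2 OI e); exists (Defs.path_map p x) => //.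
by apply: (IH _ wp); exists x.
Qed.

Lemma vimage_child w p : invariant_family Omega -> walk (vter w) p ->
  vimage Omega (child w p) `<=` vimage Omega w.
Proof.
move=> OI wp _ [x Ox <-]; exists (Defs.path_map p x) => //.
by apply: (path_map_invariant OI wp); exists x.
Qed.

Lemma vimage_descend w z : invariant_family Omega -> is_node w z ->
  vimage Omega (descend w z) `<=` vimage Omega w.
Proof.
move=> OI; elim: z w => [|p z IH] w /=; first by move=> _; exact: subset_refl.
move=> /andP[pl nz].
by apply: subset_trans (IH _ nz) _; exact: (vimage_child OI (labels_walk pl)).
Qed.

Lemma reduced_node k w : reduced_vertex F w -> vlev w = k ->
  exists w0 z, [/\ reduced_vertex F w0, vlev w0 = 0%N, is_node w0 z,
    size z = k & descend w0 z = w].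
Proof.
elim: k w => [|k IH] w wR wk; first by exists w, [::].
have [w1 [p pe]] := reduced_parent FN wR wk; have wE := reduced_edgeE pe.
have [_ w1R _] := pe; have [|w0 [z [w0R w00 nz sz zE]]] := IH w1 w1R.
  by move: wk; rewrite wE => -[].
exists w0, (rcons z p); split=> //.
- by rewrite is_node_rcons nz zE; apply/mem_labels; rewrite -wE.
- by rewrite size_rcons sz.
- by rewrite descend_rcons zE -wE.
Qed.

Lemma minlen_le (A : {fset dpath G}) u : u \in A -> (minlen A <= dlen u)%N.
Proof.
rewrite /minlen -[u \in A]/(u \in enum_fset A); move: (maxlen A) => m.
elim: (enum_fset A) => //= v s IH; rewrite inE big_cons geq_min.
by move=> /orP[/eqP <-|/IH ->]; rewrite ?leqnn ?orbT.
Qed.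

(** The ratio decays geometrically in the length of the path, and lengths at level [j] are at least
    [minlen (F j)]. *)
Lemma vratio_small e : 0 < e -> exists k, forall w, is_vertex F w ->
  (k <= vlev w)%N -> vratio w < e.
Proof.
move=> e0; have [k /andP[k0 k1] Hk] := path_ratio_exp G.
have : k ^+ j @[j --> \oo] --> (0 : R) by apply: cvg_expr; rewrite gtr0_norm.
move=> /cvgrPdist_lt/(_ _ e0)[n _ Hn].
have [m _ Hm] : (minlen (F j) @[j --> \oo]) [set j | (n <= j)%N].
  by apply: (nis_min_cvg FN); exists n.
exists m => w [u uF ->] wm; rewrite (vratio_path ab).
have := Hn _ (Hm _ wm); rewrite /= sub0r normrN gtr0_norm ?exprn_gt0// => kn.
apply: le_lt_trans (Hk _) (le_lt_trans _ kn).
by rewrite ler_wiXn2l ?(ltW k0) ?(ltW k1)// minlen_le.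
Qed.
End Tree.

(** * Types as matrix indices, and what the matrices say about single labels *)

Section Types.
Variables (R : realType) (M : metricType R) (d : Order.disp_t) (G : gifs M d).
Local Notation V := 'I_(nvert G).
Local Notation E := (gedge G).
Variables (Omega : V -> set M) (F : nat -> {fset dpath G}) (a b : M).
Hypothesis ab : a != b.
Hypothesis smap_surj : forall (e : E) y, exists x, smap e x = y.
Hypothesis FN : nested_index_sets F.
Variables (q : nat) (T : 'I_q -> set (vertex G)) (i0 : 'I_q).
Hypothesis T_types : enumerates_types Omega F T.
Variable A : R -> 'M[R]_q.
Hypothesis A_incidence : forall s, weighted_incidence Omega F T s (A s).
Implicit Types (w : vertex G) (p : seq E) (z y : seq (seq E)).
Local Notation vratio := (vratio a b).
Local Notation labels := (labels F).

(** On reduced vertices the default [i0] is never returned. *)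
Definition type_index w : 'I_q :=
  if pselect (exists i, T i = ntype Omega F w) is left H then projT1 (cid H) else i0.

Lemma type_indexP w : reduced_vertex F w -> T (type_index w) = ntype Omega F w.
Proof.
move=> wR; rewrite /type_index; case: pselect => [H|[]]; first exact: (projT2 (cid H)).
have [_ rT] := T_types; have : (ntype Omega F @` reduced_vertex F) (ntype Omega F w).
  by exists w.
by rewrite -rT => -[i _ <-]; exists i.
Qed.

Lemma type_index_repr i : exists2 w, reduced_vertex F w & type_index w = i.
Proof.
have [injT rT] := T_types; have : range T (T i) by exists i.
rewrite rT => -[w wR wE]; exists w => //.
by apply: injT; rewrite type_indexP.
Qed.

Lemma incidenceE s w j : reduced_vertex F w -> A s (type_index w) j =
  \sum_(p <- labels w | type_index (child w p) == j) path_ratio p `^ s.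
Proof.
move=> wR; rewrite (A_incidence s wR); last by rewrite type_indexP.
rewrite -[RHS]big_filter; set l := [seq _ <- labels w | _].
rewrite (_ : [set p | _] = [set` l]).
  by rewrite -fsbig_seq// filter_uniq// fset_uniq.
apply/seteqP; split=> p /=.
  move=> [w' [pe w'T]]; rewrite mem_filter; apply/andP; split.
    have [_ _ w'R] := pe; have w'E := reduced_edgeE FN pe.
    apply/eqP; rewrite -w'E; have [injT _] := T_types; apply: injT.
    by rewrite type_indexP.
  by apply/mem_labels; rewrite -(reduced_edgeE FN pe).
rewrite mem_filter => /andP[/eqP <- /mem_labels pe].
by exists (child w p); split=> //; rewrite type_indexP//; case: pe.
Qed.

Lemma sum_labels s (h : 'I_q -> R) w : reduced_vertex F w ->
  \sum_(p <- labels w) path_ratio p `^ s * h (type_index (child w p)) =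
  \sum_j A s (type_index w) j * h j.
Proof.
move=> wR; rewrite (eq_bigr _ (fun j _ => congr1 (fun t => t * h j) (incidenceE s j wR))).
rewrite (partition_big (fun p => type_index (child w p)) xpredT)//=.
apply: eq_bigr => j _; rewrite mulr_suml.
by apply: eq_bigr => p /eqP ->.
Qed.

(** At exponent -1 the entries of [A] are sums of inverse ratios, so each inverse ratio is bounded
    by one of finitely many entries. *)
Lemma path_ratio_lower : exists2 m : R, 0 < m < 1 &
  forall w p, reduced_vertex F w -> p \in labels w -> m <= path_ratio p.
Proof.
have [C C1 HC] := finite_bound (fun ij => A (-1) ij.1 ij.2) 1.
have C0 : 0 < C by exact: lt_trans C1.
exists C^-1; first by rewrite invr_gt0 C0 invf_lt1.
move=> w p wR pw; rewrite -[leRHS]invrK lef_pV2 ?posrE ?invr_gt0 ?path_ratio_gt0//.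
apply: le_trans (ltW (HC (type_index w, type_index (child w p)))).
rewrite /= incidenceE// (big_rem p)//= eqxx.
rewrite powR_inv1 ?(ltW (path_ratio_gt0 _))// lerDl sumr_ge0// => r _.
exact: powR_ge0.
Qed.

(** An empty label contributes 1 at every exponent, while the contribution of any other label tends
    to 0 as the exponent grows; equal rows of [A s] therefore detect it. *)
Lemma empty_label_type w1 w2 : reduced_vertex F w1 -> reduced_vertex F w2 ->
  type_index w1 = type_index w2 -> [::] \in labels w1 ->
  [::] \in labels w2 /\ type_index (child w1 [::]) = type_index (child w2 [::]).
Proof.
move=> w1R w2R w12 w1e; set j := type_index (child w1 [::]).
suff : [::] \in [seq p <- labels w2 | type_index (child w2 p) == j].
  by rewrite mem_filter => /andP[/eqP -> ->].
apply/negPn/negP => ne; set l := [seq _ <- _ | _] in ne.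
have [k k01 Hk] := path_ratio_exp G; have [k0 k1] := andP k01.
pose C : R := (size l)%:R + 1 + 1.
have C1 : 1 < C by rewrite ltr_pwDr// ler_wpDl.
have C0 : 0 < C := lt_trans ltr01 C1.
have [|s s0 ks] := @powR_eq_exponent _ k C^-1 k01; first by rewrite invr_gt0 C0 invf_lt1.
have : 1 <= A s (type_index w1) j.
  rewrite incidenceE// (big_rem [::])//= eqxx path_ratio_nil powR1 lerDl sumr_ge0// => r _.
  exact: powR_ge0.
rewrite w12 incidenceE// -big_filter -/l leNgt => /negP; apply.
apply: (@le_lt_trans _ _ (\sum_(p <- l) C^-1)).
  rewrite big_seq [leRHS]big_seq; apply: ler_sum => p pl; rewrite -ks.
  rewrite ge0_ler_powR ?nnegrE ?(ltW s0) ?(ltW k0) ?(ltW (path_ratio_gt0 _))//.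
  apply: le_trans (Hk p) _; case: p pl => [|e p _]; first by move/(negP ne).
  by rewrite exprS ger_pMr// exprn_ile1 ?ltW.
rewrite big_const_seq count_predT iter_addr_0 -mulr_natr mulrC ltr_pdivrMr// mul1r /C.
by rewrite -addrA ltrDl addr_gt0.
Qed.

(* Without a weight such as [g] the ratios along the edges of the reduced graph
   may be equal to 1; chains of empty labels are finite, as the lengths of the
   paths in [F k] tend to infinity. *)
Lemma edge_potential : exists g k, [/\ 0 < k < 1, forall i : 'I_q, 0 < g i :> R &
  forall w p, reduced_vertex F w -> p \in labels w ->
    path_ratio p * g (type_index (child w p)) <= k * g (type_index w)].
Proof.
(* Adjacency of types through empty labels; by [empty_label_type], an edge seen at one reduced
   vertex exists at all those of its type. *)
pose Z (i j : 'I_q) : R := `[< exists w, [/\ reduced_vertex F w, [::] \in labels w,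
  type_index w = i & type_index (child w [::]) = j] >]%:R.
have Z0 i j : 0 <= Z i j by rewrite ler0n.
have [[h [h0 [i hi] Zh]]|] := superinvariant_or_subinvariant1 Z0.
  (* A superinvariant vector would produce an endless chain of empty labels, along which the map is
     fixed while the level grows. *)
  exfalso; have step w : reduced_vertex F w -> 0 < h (type_index w) ->
      [::] \in labels w /\ 0 < h (type_index (child w [::])).
    move=> wR hw; have : exists2 j, 0 < Z (type_index w) j & 0 < h j.
      apply: contrapT => H; have := Zh (type_index w).
      rewrite mul1r leNgt => /negP; apply; rewrite big1// => j _.
      have := h0 j; rewrite le_eqVlt => /orP[/eqP <-|hj]; first by rewrite mulr0.
      have := Z0 (type_index w) j; rewrite le_eqVlt => /orP[/eqP <-|Zj]; first by rewrite mul0r.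
      by exfalso; apply: H; exists j.
    move=> [j]; rewrite /Z ltr0n lt0b => /asboolP[w1 [w1R w1e w1i <-] hj].
    by have [? <-] := empty_label_type w1R wR w1i w1e.
  have [w wR wi] := type_index_repr i.
  have chain n : exists w', [/\ reduced_vertex F w', 0 < h (type_index w'),
      vmap w' = vmap w & vlev w' = (vlev w + n)%N].
    elim: n => [|n [w' [w'R hw' w'm w'l]]]; first by exists w; rewrite wi addn0.
    have [/mem_labels[_ _ cR] hc] := step _ w'R hw'.
    by exists (child w' [::]); split=> //=; rewrite w'l addnS.
  have w0 : 0 < vratio w by apply: (vratio_gt0 ab (F := F)); case: wR.
  have [n Hn] := vratio_small ab FN w0.
  have [w' [[w'F _] _ w'm w'l]] := chain n.
  have := Hn _ w'F; rewrite w'l leq_addl => /(_ isT).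
  by rewrite (vratio_eq a b w'm) ltxx.
move=> /strictly_subinvariant_lt[c c1 [g g0 Zg]].
have empty w : reduced_vertex F w -> [::] \in labels w ->
    g (type_index (child w [::])) < c * g (type_index w).
  move=> wR we; apply: le_lt_trans (Zg (type_index w)).
  rewrite (bigD1 (type_index (child w [::])))//= [X in X * _](_ : _ = 1); last first.
    by rewrite /Z (_ : `[< _ >] = true)//; apply/asboolP; exists w.
  by rewrite mul1r lerDl sumr_ge0// => j _; rewrite mulr_ge0// ltW.
have [k /andP[k0 k1] Hk] := path_ratio_exp G.
have [D D0 HD] := finite_bound g 0.
(* Makes [k * (1 + e * D)] equal to [(1 + k) / 2]: nonempty labels contract enough to absorb the
   perturbation [e * g] of the constant potential 1. *)
pose e := (1 - k) / (2 * k * D).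
have e0 : 0 < e by rewrite divr_gt0 ?subr_gt0 ?mulr_gt0.
pose g' i := 1 + e * g i; have g'0 i : 0 < g' i.
  by rewrite /g' addr_gt0// mulr_gt0.
have [r /andP[r0 r1] Hr] : exists2 r, (1 + k) / 2 < r < 1 &
    forall i, (1 + e * (c * g i)) / g' i <= r.
  apply: finite_lt_bound; first lra.
  by move=> i; rewrite ltr_pdivrMr// mul1r /g' ltrD2l ltr_pM2l// gtr_pMl.
exists g', r; split=> //; first by apply/andP; split=> //; lra.
move=> w [|l p] wR pw.
  rewrite path_ratio_nil mul1r -ler_pdivrMr//.
  apply: le_trans (Hr (type_index w)); rewrite ler_pM2r ?invr_gt0//.
  by rewrite /g' lerD2l ler_pM2l// ltW// empty.
have pk : path_ratio (l :: p) <= k.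
  by apply: le_trans (Hk _) _; rewrite exprS ger_pMr// exprn_ile1 ?ltW.
apply: (@le_trans _ _ (k * (1 + e * D))).
  apply: ler_pM => //; rewrite ?(ltW (path_ratio_gt0 _)) ?(ltW (g'0 _))//.
  by rewrite /g' lerD2l ler_pM2l// ltW.
have -> : k * (1 + e * D) = (1 + k) / 2 by rewrite /e; field; rewrite !gt_eqF.
apply: (@le_trans _ _ r); first exact: ltW.
have : 0 < e * g (type_index w) by rewrite mulr_gt0.
rewrite /g' => ?; rewrite ler_peMr//; lra.
Qed.
End Types.

(** * Uniform bounds on the number and size of neighbors *)

Section Neighbors.
Variables (R : realType) (M : metricType R) (d : Order.disp_t) (G : gifs M d).
Local Notation V := 'I_(nvert G).
Local Notation E := (gedge G).
Variables (Omega : V -> set M) (F : nat -> {fset dpath G}) (a b : M).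
Hypothesis ab : a != b.
Hypothesis smap_surj : forall (e : E) y, exists x, smap e x = y.
Hypothesis FN : nested_index_sets F.
Hypothesis OI : invariant_family Omega.
Variables (q : nat) (T : 'I_q -> set (vertex G)) (i0 : 'I_q).
Hypothesis T_types : enumerates_types Omega F T.
Implicit Types (w v : vertex G) (p : seq E) (z y : seq (seq E)).
Local Notation vratio := (vratio a b).
Local Notation type_index := (type_index Omega F T i0).

Lemma vertex_equiv_refl w : is_vertex F w -> vertex_equiv Omega F w w.
Proof.
move=> wF; exists id, id; split.
- split=> //; first by move=> y _; have [x <-] := vmap_surj smap_surj y wF; exists x.
  rewrite image_id => x [s [sF _ _ _] sx].
  have [u [_ sE uD]] := vertexP FN sF; exists (vini s) => //.
  move: sx; rewrite sE => -[y Oy <-]; apply: (path_map_invariant OI (p := u.2)).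
    by case: u uD {sE Oy}.
  by exists y => //; move: Oy; case: u {sE uD}.
- split; first by split=> [x //|x y _ _ //|x xN]; exists x.
  by move=> s [_ sl si _]; rewrite -sl -si; case: s {sl si}.
- by split.
- by [].
Qed.

(** By reflexivity [v] lies in its own type, hence in that of [w]. *)
Lemma same_type_equiv w v : reduced_vertex F w -> reduced_vertex F v ->
  type_index w = type_index v -> vertex_equiv Omega F w v.
Proof.
move=> wR vR wv; have : ntype Omega F v v.
  by split; [case: vR|apply: vertex_equiv_refl; case: vR].
by rewrite -(type_indexP i0 T_types vR) -wv (type_indexP i0 T_types wR) => -[].
Qed.

(** As [vmap w] is onto, [tau] is a similitude of ratio [vratio v / vratio w] on all of [M]. *)
Lemma equiv_vratio w v (s t : vertex G) (tau : M -> M) : is_vertex F w -> is_vertex F v ->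
  is_vertex F s -> tau \o vmap w = vmap v -> vmap t = tau \o vmap s ->
  vratio t = vratio v / vratio w * vratio s.
Proof.
move=> wF vF sF tauE tE; have w0 := vratio_gt0 ab wF.
have tauM (x y : M) : mdist (tau x) (tau y) = vratio v / vratio w * mdist x y.
  have [x' <-] := vmap_surj smap_surj x wF; have [y' <-] := vmap_surj smap_surj y wF.
  have tauw (x1 : M) : tau (vmap w x1) = vmap v x1 by rewrite -tauE.
  by rewrite !tauw (vmapE ab _ _ vF) (vmapE ab _ _ wF) mulrA divfK// gt_eqF.
rewrite [LHS]vratioE tE /= tauM (vmapE ab _ _ sF) mulrA mulfK//.
by rewrite gt_eqF// mdist_gt0.
Qed.

(** The neighbors of [v] are carried over from those of a representative of its type, a finite set,
    and relative sizes are preserved. *)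
Lemma neighbors_bounded : exists (N : nat) (C : R), 0 < C /\
  forall v, reduced_vertex F v ->
  (exists c : nat -> vertex G,
     forall s, neighbors Omega F v s -> exists2 j, (j < N)%N & s = c j) /\
  (forall s, neighbors Omega F v s -> vratio s <= C * vratio v).
Proof.
have repr i : exists w, reduced_vertex F w /\ type_index w = i.
  by have [w wR wi] := type_index_repr i0 T_types i; exists w.
have [r rP] := choice repr.
have [C C0 HC] := finite_bound (fun i => (vratio (r i))^-1) 0.
exists (\max_i size (enum_fset (F (vlev (r i))))), C; split=> // v vR.
have [rR rv] := rP (type_index v); set w := r _ in rR rv.
have [wF _] := rR; have [vF _] := vR.
have [tau [f [[tauE _ _] [[_ _ fsurj] fE] _ _]]] := same_type_equiv rR vR rv.
have code s : neighbors Omega F v s -> exists u, [/\ u \in F (vlev w),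
    neighbors Omega F w (vertex_of (vlev w) u) & f (vertex_of (vlev w) u) = s].
  move=> /fsurj[s0 s0N <-]; have [[u uF s0E] s0l _ _] := s0N.
  by exists u; rewrite -s0l; split=> //; rewrite -s0E.
split=> [|s /code[u [uF uN <-]]].
  have [u0 _ _] := wF.
  exists (fun j => f (vertex_of (vlev w) (nth u0 (enum_fset (F (vlev w))) j))).
  move=> s /code[u [uF _ <-]]; exists (index u (enum_fset (F (vlev w)))).
    apply: leq_trans (leq_bigmax (type_index v)).
    by rewrite index_mem.
  by rewrite nth_index.
have [uV _ _ _] := uN.
have -> : vratio (f (vertex_of (vlev w) u)) =
    vratio v / vratio w * vratio (vertex_of (vlev w) u).
  by apply: (equiv_vratio wF vF uV tauE); rewrite fE.
rewrite (vratio_path ab) mulrAC -mulrA [leRHS]mulrC ler_pM2l ?(vratio_gt0 ab vF)//.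
apply: (@le_trans _ _ (1 * (vratio w)^-1)).
  by rewrite ler_pM2r ?invr_gt0 ?(vratio_gt0 ab wF)// path_ratio_le1.
by rewrite mul1r ltW// HC.
Qed.
End Neighbors.

(** * Stopped nodes and their number near a point *)

Section Counting.
Variables (R : realType) (M : metricType R) (d : Order.disp_t) (G : gifs M d).
Local Notation V := 'I_(nvert G).
Local Notation E := (gedge G).
Variables (Omega : V -> set M) (F : nat -> {fset dpath G}) (a b : M).
Hypothesis ab : a != b.
Hypothesis smap_surj : forall (e : E) y, exists x, smap e x = y.
Hypothesis FN : nested_index_sets F.
Hypothesis OI : invariant_family Omega.
Variables (q : nat) (T : 'I_q -> set (vertex G)) (i0 : 'I_q).
Hypothesis T_types : enumerates_types Omega F T.
Variables (n : nat) (K : V -> set M).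
Hypothesis M_at : forall x : M, euclidean_at n x.
Hypothesis K_self_similar : self_similar_family K.
Implicit Types (w v : vertex G) (p : seq E) (z y : seq (seq E)).
Local Notation vratio := (vratio a b).
Local Notation type_index := (type_index Omega F T i0).
Local Notation labels := (labels F).
Variables (m k : R) (g : 'I_q -> R).
Hypothesis m01 : 0 < m < 1.
Hypothesis m_le : forall w p, reduced_vertex F w -> p \in labels w -> m <= path_ratio p.
Hypothesis k01 : 0 < k < 1.
Hypothesis g0 : forall i, 0 < g i.
Hypothesis g_edge : forall w p, reduced_vertex F w -> p \in labels w ->
  path_ratio p * g (type_index (child w p)) <= k * g (type_index w).

Let m0 : 0 < m. Proof. by case/andP: m01. Qed.
Let k0 : 0 < k. Proof. by case/andP: k01. Qed.

Definition weight w := vratio w * g (type_index w).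

Lemma weight_gt0 w : reduced_vertex F w -> 0 < weight w.
Proof. by move=> [wF _]; rewrite mulr_gt0// (vratio_gt0 ab wF). Qed.

Lemma weight_child w p : reduced_vertex F w -> p \in labels w ->
  weight (child w p) <= k * weight w.
Proof.
move=> wR pw; have [wF _] := wR.
rewrite /weight (vratio_child ab _ wF) -mulrA [leRHS]mulrCA ler_pM2l ?(vratio_gt0 ab wF)//.
exact: g_edge.
Qed.

Lemma weight_descend w z : reduced_vertex F w -> is_node F w z ->
  weight (descend w z) <= k ^+ size z * weight w.
Proof.
move=> wR; elim/last_ind: z => [|z p IH]; first by rewrite mul1r.
rewrite is_node_rcons descend_rcons size_rcons exprS => /andP[nz pz].
have zR := descend_reduced wR nz.
by rewrite (le_trans (weight_child zR pz))// -mulrA ler_pM2l// IH.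
Qed.

(** As weights decrease along branches, this is the first node where the threshold is passed; [w]
    itself is never stopped. *)
Definition stopped w r z := [/\ is_node F w z, weight (descend w z) <= r &
  exists z' p, z = rcons z' p /\ r < weight (descend w z')].

Lemma stopped_prefix w r z : is_node F w z -> weight (descend w z) <= r ->
  r < weight w -> exists2 y, prefix y z & stopped w r y.
Proof.
elim/last_ind: z => [|z p IH]; first by move=> _ /le_lt_trans/[apply]; rewrite ltxx.
move=> nz zr rw; have := nz; rewrite is_node_rcons => /andP[nz' _].
have [z'r|rz'] := leP (weight (descend w z)) r.
  have [y yz yS] := IH nz' z'r rw; exists y => //.
  exact: prefix_trans yz (prefix_rcons _ _).
by exists (rcons z p); [exact: prefix_refl|split=> //; exists z, p].
Qed.

Lemma weight_bounds : exists c C : R, [/\ 0 < c, 0 < C &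
  forall w, reduced_vertex F w -> c * vratio w <= weight w <= C * vratio w].
Proof.
have [C C0 HC] := finite_bound g 0.
have [c c0 Hc] := finite_bound (fun i => (g i)^-1) 0.
exists c^-1, C; split; [by rewrite invr_gt0|by []|move=> w [wF _]].
have vw := vratio_gt0 ab wF; rewrite /weight; apply/andP; split.
  rewrite mulrC ler_pM2l// -[leRHS]invrK lef_pV2 ?posrE ?invr_gt0//.
  exact: ltW.
by rewrite [leRHS]mulrC ler_pM2l// ltW.
Qed.

(** The parent has weight above [r] and the last label has ratio at least [m], so the cell is not
    much smaller than [r]. *)
Lemma stopped_bounds : exists c1 c2 : R, [/\ 0 < c1, 0 < c2 &
  forall w r z, reduced_vertex F w -> stopped w r z ->
    c1 * r <= vratio (descend w z) <= c2 * r].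
Proof.
have [c [C [c0 C0 H]]] := weight_bounds.
exists (m / C), c^-1; rewrite divr_gt0// invr_gt0; split=> // w r z wR.
move=> [nz zr [z' [p [zE rz']]]]; have zR := descend_reduced wR nz.
have /andP[cz _] := H _ zR; apply/andP; split; last first.
  by rewrite mulrC ler_pdivlMr// mulrC (le_trans cz).
move: nz; rewrite zE is_node_rcons => /andP[nz' pz'].
have z'R := descend_reduced wR nz'; have /andP[_ z'C] := H _ z'R.
have [z'F _] := z'R; rewrite descend_rcons (vratio_child ab _ z'F).
have r0 : 0 <= r by apply: le_trans zr; exact/ltW/weight_gt0.
have -> : m / C * r = r / C * m by ring.
apply: ler_pM; rewrite ?divr_ge0 ?(ltW m0) ?(ltW C0)//; last exact: (m_le z'R).
by rewrite ler_pdivrMr// mulrC ltW// (lt_le_trans rz').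
Qed.

(* Cut all the nodes of [s] at the level of the highest one, obtaining
   neighbours of the latter. *)
Lemma overlapping_bounded : exists N : nat, forall w r (s : seq (seq (seq E))),
  reduced_vertex F w -> 0 < r -> uniq s -> (forall z, z \in s -> stopped w r z) ->
  (forall z y, z \in s -> y \in s ->
     vimage Omega (descend w z) `&` vimage Omega (descend w y) !=set0) ->
  (size s <= N)%N.
Proof.
have [c1 [c2 [c10 c20 Hc]]] := stopped_bounds.
have [cw [Cw [cw0 Cw0 Hw]]] := weight_bounds.
have [N1 [C1 [C10 HN]]] := neighbors_bounded ab smap_surj FN OI i0 T_types.
have [r1 /andP[r10 r11] Hr1] := path_ratio_exp G.
have pow_small (t : R) : 0 < t < 1 -> forall e : R, 0 < e -> exists j, t ^+ j < e.
  move=> /andP[t0 t1] e e0; have : t ^+ j @[j --> \oo] --> (0 : R).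
    by apply: cvg_expr; rewrite gtr0_norm.
  move=> /cvgrPdist_lt/(_ _ e0)[j _ /(_ j (leqnn j))].
  by rewrite /= sub0r normrN gtr0_norm ?exprn_gt0//; exists j.
(* A label longer than [L] would have ratio below [m]. *)
have [L HL] := pow_small r1 (introT andP (conj r10 r11)) m m0.
(* A node more than [D] levels below a neighbor of the highest node would be too light to be stopped
   at [r]. *)
have [D HD] := pow_small k k01 (cw * c1 / (Cw * (C1 * c2)))
  (ltac:(by rewrite divr_gt0 ?mulr_gt0)).
pose Y := words (words (enum E) L) D.
exists (size [seq (i, y) | i <- iota 0 N1, y <- Y]).
move=> w r s wR r0 us sS sO.
case: s us sS sO => // x0 s' us sS sO; set s := x0 :: s' in us sS sO *.
have [z0 z0s Hz0] : exists2 z0, z0 \in s & forall z, z \in s -> (size z0 <= size z)%N.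
  have [z0 z0s Hz0] := @arg_minnP _ (Ordinal (ltn0Sn (size s')) : 'I_(size s)) xpredT
    (fun i : 'I_(size s) => size (nth x0 s i)) isT.
  exists (nth x0 s z0); first by rewrite mem_nth.
  move=> z zs; have zi : (index z s < size s)%N by rewrite index_mem.
  by have := Hz0 (Ordinal zi) isT; rewrite /= nth_index.
have [n0 _ _] := sS _ z0s; have z0R := descend_reduced wR n0.
have [[code Hcode] HC] := HN _ z0R.
have /andP[_ z0c2] := Hc _ _ _ wR (sS _ z0s).
pose t z := take (size z0) z.
have tP z : z \in s -> [/\ is_node F w (t z), is_node F (descend w (t z)) (drop (size z0) z),
    neighbors Omega F (descend w z0) (descend w (t z)) &
    drop (size z0) z \in Y].
  move=> zs; have [nz _ _] := sS _ zs.
  have := nz; rewrite -{1}(cat_take_drop (size z0) z) is_node_cat => /andP[nt nd].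
  have tR := descend_reduced wR nt; have tF : is_vertex F (descend w (t z)) by case: tR.
  have tN : neighbors Omega F (descend w z0) (descend w (t z)).
    split=> //; rewrite ?vlev_descend ?vini_descend//.
      by rewrite /t size_takel// Hz0.
    have [x [x0' xz]] := sO _ _ z0s zs; exists x; split=> //.
    have := @vimage_descend _ _ _ _ Omega F FN (descend w (t z)) _ OI nd.
    by rewrite -descend_cat cat_take_drop; exact.
  split=> //; apply: mem_words.
    rewrite leqNgt; apply/negP => Dz; have /andP[zc1 _] := Hc _ _ _ wR (sS _ zs).
    have zR := descend_reduced wR nz.
    have /andP[zw _] := Hw _ zR; have /andP[_ tw] := Hw _ tR.
    have := weight_descend tR nd; rewrite -descend_cat cat_take_drop leNgt => /negP; apply.
    apply: (@lt_le_trans _ _ (cw * (c1 * r))); last first.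
      by apply: le_trans zw; rewrite ler_pM2l.
    apply: (@le_lt_trans _ _ (k ^+ D * (Cw * (C1 * (c2 * r))))).
      apply: ler_pM; rewrite ?exprn_ge0 ?(ltW k0) ?(ltW (weight_gt0 tR))//.
        have /andP[_ k1] := k01; apply: ler_wiXn2l; rewrite ?(ltW k0) ?(ltW k1)//.
        exact: ltnW.
      apply: (le_trans tw); rewrite ler_pM2l//.
      by apply: (le_trans (HC _ tN)); rewrite ler_pM2l.
    rewrite !mulrA ltr_pM2r// -!mulrA -ltr_pdivlMr ?mulr_gt0//.
  have sub : forall w' y, reduced_vertex F w' -> is_node F w' y ->
      {subset y <= words (enum E) L}.
    move=> w' y; elim: y w' => // p y IH w' w'R /= /andP[pl ny] p'.
    rewrite inE => /orP[/eqP ->|p'y].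
      apply: mem_words; last by move=> e _; rewrite mem_enum.
      rewrite leqNgt; apply/negP => Lp; have := m_le w'R pl; rewrite leNgt => /negP; apply.
      apply: le_lt_trans (Hr1 p) (le_lt_trans _ HL).
      by apply: ler_wiXn2l; rewrite ?(ltW r10) ?(ltW r11)// ltnW.
    have cR : reduced_vertex F (child w' p) by have /mem_labels[] := pl.
    exact: IH cR ny _ p'y.
  exact: (sub _ _ tR nd).
(* A node is determined by the number of its ancestor among the neighbors of [z0] and by the labels
   leading down from it. *)
pose P z (j : nat * seq (seq E)) :=
  descend w (t z) = code j.1 /\ drop (size z0) z = j.2.
apply: (@size_le_code _ _ _ _ P us).
  move=> z zs; have [_ _ tN dY] := tP z zs; have [j jN1 jE] := Hcode _ tN.
  exists (j, drop (size z0) z); last by split.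
  by apply/allpairsP; exists (j, drop (size z0) z); rewrite /= mem_iota.
move=> z y j zs ys [tz dz] [ty dy].
have [ntz _ _ _] := tP z zs; have [nty _ _ _] := tP y ys.
rewrite -(cat_take_drop (size z0) z) -(cat_take_drop (size z0) y) dz dy.
congr (_ ++ _); apply: (descend_inj smap_surj FN ntz nty).
by rewrite tz ty.
Qed.
(* Nodes whose images of a chosen point of [Omega] lie in the same cell of a fine
   grid overlap, so that [overlapping_bounded] applies to each cell. *)
Lemma stopped_count : exists N : nat, forall w x r (s : seq (seq (seq E))),
  reduced_vertex F w -> K (vini w) x -> 0 < r -> uniq s ->
  (forall z, z \in s -> stopped w r z /\
     exists2 t, vcell K (descend w z) t & mdist x t < r) ->
  (size s <= N)%N.
Proof.
have [N HN] := overlapping_bounded.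
have [c1 [c2 [c10 c20 Hc]]] := stopped_bounds.
(* Centre and radius of a ball inside each [Omega j]. *)
have /choice[ct ctP] : forall j, exists y : M * R, 0 < y.2 /\
    forall t, mdist y.1 t < y.2 -> Omega j t.
  move=> j; have [[y Oy] /open_mdist/(_ y Oy)[e e0 He] _] := proj1 OI j.
  by exists (y, e).
have [D' D'0 HD'] := finite_bound (fun j => (ct j).2^-1) 0.
have [B B0 HB] := attractor_bounded K_self_similar.
have /choice[kp kpP] : forall j, exists x, K j x.
  by move=> j; have [[x Kx] _] := proj1 K_self_similar j; exists x.
have [D D0 HD] := finite_bound (fun j => mdist (ct j).1 (kp j)) 0.
have oK j t : K j t -> mdist (ct j).1 t <= D + B.
  move=> Kt; apply: le_trans (metric_triangle _ (kp j) _) _.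
  by apply: lerD; [exact/ltW/HD|exact: HB].
(* Bound for the distance from [x] to a centre, in units of [r]: 1 to reach the cell, [c2 * (D + B)]
   from there to the centre, and a margin of 1. *)
have C0 : 0 < 1 + c2 * (D + B) + 1 by rewrite !addr_gt0// mulr_gt0// addr_gt0.
(* In units of [r], at most the radius of the image of the chosen ball under a stopped node. *)
have c0 : 0 < c1 / D' by rewrite divr_gt0.
have [I HI] := compact_grid C0 c0 M_at.
exists (#|I| * N)%N => w x r s wR Kx r0 us sP.
(* The loop that [compact_grid] iterates; its map sends [K (vini w)] into itself. *)
have [e [es et]] := gedge_exists (vini w) (vini w).
have eK : smap e @` K (vini w) `<=` K (vini w).
  move=> _ [t Kt <-]; rewrite (proj2 K_self_similar (vini w)); exists e => //.
  by rewrite et; exists t.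
have [cell Hcell] := HI _ _ _ (ratio_bounds e) (smap_similitude e)
  (proj2 (proj1 K_self_similar (vini w))) eK x r Kx r0.
pose center z := vmap (descend w z) (ct (vter (descend w z))).1.
have sE : size s = (\sum_(i : I) size [seq z <- s | cell (center z) == i])%N.
  rewrite -sum1_size (partition_big (fun z => cell (center z)) xpredT)//=.
  by apply: eq_bigr => i _; rewrite -big_filter sum1_size.
rewrite sE -sum_nat_const; apply: leq_sum => i _.
apply: (HN w r) => //; first exact: filter_uniq.
  by move=> z; rewrite mem_filter => /andP[_ /sP[]].
have near z : z \in s -> mdist x (center z) < (1 + c2 * (D + B) + 1) * r.
  move=> /sP[zS [t tz xt]]; have [nz _ _] := zS.
  have [zF _] := descend_reduced wR nz.
  have /andP[_ vz] := Hc _ _ _ wR zS.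
  apply: le_lt_trans (metric_triangle _ t _) _.
  have : mdist t (center z) <= c2 * r * (D + B).
    have [u Ku <-] := tz; rewrite (vmapE ab _ _ zF) metric_sym.
    apply: ler_pM => //; [exact/ltW/(vratio_gt0 ab zF)|exact: mdist_ge0|exact: oK].
  move=> tc; have -> : (1 + c2 * (D + B) + 1) * r = r + (c2 * r * (D + B) + r) by ring.
  by rewrite ltrD// (le_lt_trans tc)// ltrDl.
move=> z y; rewrite !mem_filter => /andP[/eqP zi zs] /andP[/eqP yi ys].
exists (center z); split.
  exists (ct (vter (descend w z))).1 => //.
  by have [c0'] := ctP (vter (descend w z)); apply; rewrite mdistxx.
have [yS _] := sP _ ys; have [ny _ _] := yS.
have [yF _] := descend_reduced wR ny; have /andP[vy _] := Hc _ _ _ wR yS.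
(* The centre of [z] is pulled back by the map of [y]; the preimage is close enough to the chosen
   centre to lie in [Omega]. *)
have [t tE] := vmap_surj smap_surj (center z) yF.
exists t => //; have [cty0 oyH] := ctP (vter (descend w y)); apply: oyH.
have := Hcell _ _ (near z zs) (near y ys) (etrans zi (esym yi)).
rewrite -tE (vmapE ab _ _ yF) metric_sym => H.
have vy0 := vratio_gt0 ab yF; rewrite -(ltr_pM2l vy0); apply: (lt_le_trans H).
rewrite mulrAC; apply: ler_pM => //; rewrite ?mulr_ge0 ?invr_ge0 ?(ltW c10) ?(ltW r0) ?(ltW D'0)//.
by rewrite -[leRHS]invrK lef_pV2 ?posrE ?invr_gt0// ltW.
Qed.
End Counting.

(** * Hausdorff measure and dimension *)

Section Hausdorff.
Variables (R : realType) (M : metricType R).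
Implicit Types (A : set M) (s : R).
Local Open Scope ereal_scope.

Lemma diam_ge A x y : A x -> A y -> (mdist x y)%:E <= diam A.
Proof. by move=> Ax Ay; apply: ereal_sup_ubound; exists (x, y). Qed.

Lemma diam_le A (c : R) : (forall x y, A x -> A y -> (mdist x y <= c)%R) ->
  diam A <= c%:E.
Proof. by move=> H; apply: ge_ereal_sup => _ [[x y] [Ax Ay] <-]; rewrite lee_fin H. Qed.

Lemma diam_ge0 A : A !=set0 -> 0 <= diam A.
Proof. by move=> [x Ax]; apply: le_trans (diam_ge Ax Ax); rewrite mdistxx. Qed.

Lemma diam_pow0 s : diam_pow s (set0 : set M) = 0.
Proof. by rewrite /diam_pow eqxx. Qed.

Lemma diam_pow_ge0 s A : 0 <= diam_pow s A.
Proof. by rewrite /diam_pow; case: ifPn => // _; exact: poweR_ge0. Qed.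

Lemma diam_pow_le s A (c : R) : (0 <= s)%R -> (0 <= c)%R ->
  (forall x y, A x -> A y -> (mdist x y <= c)%R) -> diam_pow s A <= (c `^ s)%:E.
Proof.
move=> s0 c0 H; rewrite /diam_pow; case: ifPn => [_|/set0P A0].
  by rewrite lee_fin powR_ge0.
have := diam_le H; have := diam_ge0 A0; case: (diam A) => [r||] //=.
rewrite !lee_fin => r0 rc.
by rewrite ge0_ler_powR.
Qed.

Lemma hausdorff_content_ge0 s (e : R) A : 0 <= hausdorff_content s e A.
Proof.
apply: le_ereal_inf_tmp => _ [U _ <-]; apply: nneseries_ge0 => i _ _.
exact: diam_pow_ge0.
Qed.

(** The list is padded with empty sets, which contribute 0 even for [s = 0]. *)
Lemma hausdorff_content_finite_cover s (e : R) A (I : eqType) (l : seq I)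
    (f : I -> set M) : (0 < e)%R ->
  (forall i, i \in l -> forall x y, f i x -> f i y -> (mdist x y <= e)%R) ->
  A `<=` \bigcup_(i in [set` l]) f i ->
  hausdorff_content s e A <= \sum_(i <- l) diam_pow s (f i).
Proof.
move=> e0 fe Al.
pose U j := if ohead (drop j l) is Some i then f i else set0.
have UE j i : (j < size l)%N -> U j = f (nth i l j).
  by move=> jl; rewrite /U (drop_nth i jl).
have U0 j : (size l <= j)%N -> U j = set0 by move=> jl; rewrite /U drop_oversize.
apply: (@le_trans _ _ (\sum_(0 <= j <oo) diam_pow s (U j))); last first.
  rewrite (nneseries_split 0 (size l)) => [|j _]; last exact: diam_pow_ge0.
  rewrite add0n eseries0 ?adde0; last by move=> j jl _; rewrite U0// diam_pow0.
  case: l {fe Al} U UE U0 => [|i l] U UE U0; first by rewrite !big_nil.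
  rewrite (big_nth i) (@eq_big_nat _ _ _ _ _ _ (fun j => diam_pow s (f (nth i (i :: l) j))))//.
  by move=> j /andP[_ jl]; rewrite (UE _ i).
apply: ereal_inf_lbound; exists U => //; split=> [j|x /Al[i /= il fx]].
  apply: diam_le => x y; rewrite /U; have := @mem_drop j _ l.
  by case: (drop j l) => // i l' /(_ i (mem_head _ _)) il; exact: fe.
exists (index i l) => //; rewrite (UE _ i) ?index_mem// nth_index//.
Qed.

(** Lets a covering set, even a single point, be enlarged to an open ball at little cost. For
    [s = 0] the powers are constant and the midpoint will do. *)
Lemma small_radius (s D W e : R) : (0 <= s -> 0 <= D -> D < W -> 0 < e ->
  exists2 r, D < r < W & r `^ s <= D `^ s + e)%R.
Proof.
move=> s0 D0 DW e0; have : (0 <= s)%R by [].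
rewrite le_eqVlt => /orP[/eqP <-|sp].
  exists ((D + W) / 2)%R; first by apply/andP; split; lra.
  by rewrite !powRr0 lerDl ltW.
pose t := ((D `^ s + e) `^ s^-1)%R.
have te : (t `^ s = D `^ s + e)%R.
  by rewrite /t -powRrM mulVf ?gt_eqF// powRr1// addr_ge0 ?powR_ge0// ltW.
have Dt : (D < t)%R.
  have -> : (D = (D `^ s) `^ s^-1)%R by rewrite -powRrM mulfV ?gt_eqF// powRr1.
  by rewrite gt0_ltr_powR ?invr_gt0 ?nnegrE ?powR_ge0 ?addr_ge0 ?powR_ge0 ?(ltW e0)// ltrDl.
exists (Num.min t ((D + W) / 2))%R.
  rewrite lt_min Dt gt_min; apply/andP; split; first by lra.
  by apply/orP; right; lra.
rewrite -te ge0_ler_powR// ?nnegrE ?ge_min ?lexx//.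
  by rewrite le_min powR_ge0; lra.
exact: powR_ge0.
Qed.

Lemma sum_half_lt1 n : (\sum_(0 <= i < n) (2^-1) ^+ i.+1 < 1 :> R)%R.
Proof.
suff -> : (\sum_(0 <= i < n) (2^-1) ^+ i.+1 = 1 - 2^-1 ^+ n :> R)%R.
  by rewrite gtrBl exprn_gt0.
elim: n => [|n IH]; first by rewrite big_geq// expr0 subrr.
by rewrite big_nat_recr//= IH !exprS; lra.
Qed.

Lemma lee_sum_subseq (I : {fset nat}) (f : nat -> \bar R) : (forall i, 0 <= f i) ->
  \sum_(i <- I) f i <= \sum_(0 <= i <oo) f i.
Proof.
move=> f0; pose n := (\max_(i <- I) i).+1.
apply: le_trans (nneseries_lim_ge n (fun i _ _ => f0 i)).
have -> : \sum_(i <- I) f i = \sum_(0 <= i < n | i \in I) f i.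
  rewrite -[RHS]big_filter; apply: perm_big; apply: uniq_perm.
  - exact: fset_uniq.
  - by rewrite filter_uniq// iota_uniq.
  - move=> i; rewrite mem_filter mem_index_iota /= ltnS.
    case iI : (i \in I) => //=; rewrite ?iI.
    by apply/esym; apply: leq_bigmax_seq.
rewrite [leRHS](bigID (fun i => i \in I)) /= leeDl//.
by apply: sume_ge0 => i _.
Qed.

End Hausdorff.

(** * Mass on levels and cuts, and the two bounds on the dimension *)

Section Mass.
Variables (R : realType) (M : metricType R) (d : Order.disp_t) (G : gifs M d).
Local Notation V := 'I_(nvert G).
Local Notation E := (gedge G).
Variables (Omega : V -> set M) (F : nat -> {fset dpath G}) (a b : M).
Hypothesis ab : a != b.
Hypothesis smap_surj : forall (e : E) y, exists x, smap e x = y.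
Hypothesis FN : nested_index_sets F.
Hypothesis OI : invariant_family Omega.
Variables (q : nat) (T : 'I_q -> set (vertex G)) (i0 : 'I_q).
Hypothesis T_types : enumerates_types Omega F T.
Variables (n : nat) (K : V -> set M).
Hypothesis M_at : forall x : M, euclidean_at n x.
Hypothesis K_self_similar : self_similar_family K.
Variable A : R -> 'M[R]_q.
Hypothesis A_incidence : forall s, weighted_incidence Omega F T s (A s).
Implicit Types (w v : vertex G) (p : seq E) (z y : seq (seq E)).
Local Notation vratio := (vratio a b).
Local Notation type_index := (type_index Omega F T i0).
Local Notation labels := (labels F).
Local Notation is_node := (is_node F).
Local Notation reduced_vertex := (reduced_vertex F).

Definition mass s (h : 'I_q -> R) w := vratio w `^ s * h (type_index w).

Lemma mass_labels s h w : reduced_vertex w ->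
  \sum_(p <- labels w) mass s h (child w p) =
  vratio w `^ s * \sum_j A s (type_index w) j * h j.
Proof.
move=> wR; have [wF _] := wR.
rewrite -(sum_labels FN i0 T_types A_incidence s h wR) mulr_sumr; apply: eq_bigr => p _.
rewrite /mass (vratio_child ab _ wF) powRM ?mulrA//.
  exact/ltW/(vratio_gt0 ab wF).
exact/ltW/path_ratio_gt0.
Qed.

Fixpoint nodes (j : nat) w : seq (seq (seq E)) :=
  if j is j'.+1 then flatten [seq map (cons p) (nodes j' (child w p)) | p <- labels w]
  else [:: [::]].

Lemma mem_nodes j w z : z \in nodes j w = is_node w z && (size z == j).
Proof.
elim: j w z => [|j IH] w [|p z] //=.
- by rewrite andbF.
- by apply/negP => /flatten_mapP[p _ /mapP[]].
rewrite eqSS -andbA -IH; apply/flatten_mapP/andP => [[r rl /mapP[y yn [-> ->]]]|[pl zn]].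
  by split.
by exists p => //; apply/mapP; exists z.
Qed.

Lemma mass_nodes s h c j w : (forall i, 0 <= h i) -> 0 <= c ->
  (forall i, \sum_l A s i l * h l <= c * h i) -> reduced_vertex w ->
  \sum_(z <- nodes j w) mass s h (descend w z) <= c ^+ j * mass s h w.
Proof.
move=> h0 c0 Ah; elim: j w => [|j IH] w wR.
  by rewrite /= big_seq1 mul1r.
rewrite big_flatten big_map.
apply: (@le_trans _ _ (\sum_(p <- labels w) c ^+ j * mass s h (child w p))).
  rewrite big_seq [leRHS]big_seq; apply: ler_sum => p pl.
  by rewrite big_map; apply: IH; case/mem_labels: pl.
rewrite -mulr_sumr mass_labels// exprSr -!mulrA ler_wpM2l ?exprn_ge0//.
by rewrite /mass mulrCA ler_wpM2l ?powR_ge0.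
Qed.

Lemma mass_cut s h j w (Z : seq (seq (seq E))) : (forall i, 0 <= h i) ->
  (forall i, h i <= \sum_l A s i l * h l) -> reduced_vertex w ->
  (forall z, is_node w z -> size z = j -> exists2 y, y \in Z & prefix y z) ->
  mass s h w <= \sum_(z <- Z) mass s h (descend w z).
Proof.
move=> h0 Ah; have mass0 v : 0 <= mass s h v by rewrite mulr_ge0 ?powR_ge0.
elim: j w Z => [|j IH] w Z wR HZ.
  have [//|y yZ] := HZ [::] isT; rewrite prefixs0 => /eqP yE.
  by rewrite (big_rem y)//= yE lerDl sumr_ge0.
have [nilZ|nilZ] := boolP ([::] \in Z).
  by rewrite (big_rem _ nilZ)/= lerDl sumr_ge0.
apply: (@le_trans _ _ (\sum_(p <- labels w) mass s h (child w p))).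
  by rewrite mass_labels// ler_wpM2l ?powR_ge0.
(* The cut is split by first labels; each part is a cut below the corresponding child. *)
pose Zp p := [seq behead z | z <- Z & ohead z == Some p].
apply: (@le_trans _ _ (\sum_(p <- labels w) \sum_(z <- Zp p) mass s h (descend (child w p) z))).
  rewrite big_seq [leRHS]big_seq; apply: ler_sum => p pl; apply: IH.
    by case/mem_labels: pl.
  move=> z nz sz; have [||y yZ yz] := HZ (p :: z); first by rewrite /= pl.
    by rewrite /= sz.
  case: y yZ yz => [|r y] yZ; first by rewrite yZ in nilZ.
  rewrite /= => /andP[/eqP rp yz]; exists y => //.
  by apply/mapP; exists (r :: y); rewrite // mem_filter /= rp eqxx -rp.
apply: (@le_trans _ _ (\sum_(p <- labels w) \sum_(z <- Z)
    (if ohead z == Some p then mass s h (descend w z) else 0))).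
  apply: ler_sum => p _; rewrite big_map big_filter big_mkcond.
  apply: ler_sum => -[|r z] _ //=.
  by case: eqP => // -[->].
rewrite exchange_big /=; apply: ler_sum => z _.
case: z => [|r z] /=; first by rewrite big1.
have [rl|rl] := boolP (r \in labels w).
  rewrite (bigD1_seq r)//= ?fset_uniq// eqxx big1 ?addr0// => p pr.
  by case: eqP => // -[] rp; rewrite rp eqxx in pr.
rewrite big_seq big1 => [|p pl]; first exact: mass0.
by case: eqP => // -[] rp; rewrite rp pl in rl.
Qed.

Lemma upper_dimension t : 0 <= t -> strictly_subinvariant (A t) 1 ->
  hausdorff_measure t (\bigcup_i K i) = 0%E.
Proof.
move=> t0 /strictly_subinvariant_lt[c c1 [g g0 Ag]].
pose c' := Num.max c 0; have c'0 : 0 <= c' by rewrite le_max lexx orbT.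
have c'1 : c' < 1 by rewrite gt_max c1 ltr01.
have Ag' i : \sum_l A t i l * g l <= c' * g i.
  by apply: le_trans (ltW (Ag i)) _; rewrite ler_pM2r// le_max lexx.
have [B B0 HB] := attractor_bounded K_self_similar.
have [D D0 HD] := finite_bound (fun i => (g i)^-1) 0.
pose root i : vertex G := vertex_of 0 (i, [::]).
pose roots := [seq i <- enum V | `[< reduced_vertex (root i) >]].
pose S := \sum_(i <- roots) mass t g (root i).
have content e : 0 < e -> hausdorff_content t e (\bigcup_i K i) = 0%E.
  move=> e0; apply/eqP; rewrite eq_le hausdorff_content_ge0 andbT.
  apply/lee_addgt0Pr => r r0; rewrite add0e.
  have [k Hk] := vratio_small ab FN (divr_gt0 e0 B0).
  (* Deep enough for cells of diameter at most [e] and a total at most [r]; the factors [B] and [D]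
     turn powers of diameters into masses. *)
  have [j kj Hj] : exists2 j, (k <= j)%N & B `^ t * D * c' ^+ j * S <= r.
    have : B `^ t * D * c' ^+ j * S @[j --> \oo] --> B `^ t * D * 0 * S.
      apply: cvgMl; apply: cvgMr; apply: cvg_expr; rewrite ger0_norm//.
    rewrite mulr0 mul0r => /cvgrPdist_lt/(_ _ r0)[j0 _ H].
    exists (maxn j0 k); first exact: leq_maxr.
    have := H _ (leq_maxl j0 k); rewrite /= sub0r normrN => /ltW.
    by apply: le_trans; exact: ler_norm.
  pose I := [seq (i, z) | i <- roots, z <- nodes j (root i)].
  pose f (iz : V * seq (seq E)) := vcell K (descend (root iz.1) iz.2).
  have IP i z : (i, z) \in I -> [/\ reduced_vertex (root i), is_node (root i) z & size z = j].
    move=> /allpairsPdep[i1 [z1 [i1r z1n [-> ->]]]].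
    move: i1r; rewrite mem_filter => /andP[/asboolP ? _].
    by move: z1n; rewrite mem_nodes => /andP[? /eqP].
  have fB i z (x y : M) : (i, z) \in I -> f (i, z) x -> f (i, z) y ->
      mdist x y <= vratio (descend (root i) z) * B.
    move=> /IP[rR nz _] [x' Kx <-] [y' Ky <-].
    have [zF _] := descend_reduced rR nz.
    by rewrite (vmapE ab _ _ zF) ler_pM2l ?(vratio_gt0 ab zF)//; exact: HB Kx Ky.
  apply: (@le_trans _ _ (\sum_(iz <- I) diam_pow t (f iz))%E).
    apply: hausdorff_content_finite_cover => //.
      move=> [i z] izI x y fx fy; apply: (le_trans (fB _ _ _ _ izI fx fy)).
      have [rR nz sz] := IP _ _ izI; have [zF _] := descend_reduced rR nz.
      by rewrite -ler_pdivlMr// ltW// Hk// vlev_descend sz.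
    move=> x [i _ Kx]; have [w [wR wj wi wx]] := attractor_reduced FN K_self_similar j Kx.
    have [w0 [z [w0R w00 nz sz zE]]] := reduced_node FN wR wj.
    have w0E : w0 = root (vini w0).
      have [[[u1 u2] uF uE] _] := w0R; rewrite w00 in uF uE.
      by move: uF; rewrite (nis_zero FN) => /eqP /= u20; rewrite uE u20.
    exists (vini w0, z); last by rewrite /f /= -w0E zE.
    apply/allpairsPdep; exists (vini w0), z; split=> //.
      by rewrite mem_filter mem_enum andbT; apply/asboolP; rewrite -w0E.
    by rewrite mem_nodes -w0E nz sz eqxx.
  apply: (@le_trans _ _ (\sum_(iz <- I)
      (B `^ t * D * mass t g (descend (root iz.1) iz.2))%:E)%E).
    rewrite big_seq [leRHS]big_seq; apply: lee_sum => -[i z] izI.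
    have [rR nz sz] := IP _ _ izI; have [zF _] := descend_reduced rR nz.
    have z0 := vratio_gt0 ab zF.
    apply: le_trans (diam_pow_le t0 _ (fun x1 x2 => fB i z x1 x2 izI)) _.
      by rewrite mulr_ge0// ltW.
    rewrite lee_fin powRM ?(ltW z0) ?(ltW B0)// /mass mulrC -mulrA ler_wpM2l ?powR_ge0//=.
    rewrite mulrCA ler_peMr ?powR_ge0// -ler_pdivrMr// div1r ltW//.
  rewrite sumEFin lee_fin; apply: le_trans Hj.
  rewrite -mulr_sumr /I big_allpairs_dep /= -!mulrA ler_wpM2l ?powR_ge0// ler_wpM2l ?(ltW D0)//.
  rewrite /S mulr_sumr big_seq [leRHS]big_seq; apply: ler_sum => i.
  rewrite mem_filter => /andP[/asboolP rR _].
  by apply: mass_nodes => // l; exact: ltW.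
rewrite /hausdorff_measure (_ : [set _ | _ in _] = [set 0%E]) ?ereal_sup1//.
apply/seteqP; split=> [_ [e /= e0 <-]|_ ->] /=; first exact: content.
by exists 1 => //; exact: content.
Qed.
Lemma lower_dimension t : 0 <= t -> superinvariant (A t) 1 ->
  hausdorff_measure t (\bigcup_i K i) != 0%E.
Proof.
move=> t0 [h [h0 [i1 hi1] Ah]].
have {}Ah i : h i <= \sum_l A t i l * h l by rewrite -[leLHS]mul1r.
have [w0 w0R w0i] := type_index_repr i0 T_types i1.
have [m m01 m_le] := path_ratio_lower FN i0 T_types A_incidence.
have [g [k [k01 g0 g_edge]]] := edge_potential ab FN i0 T_types A_incidence.
have [k0 k1] := andP k01.
have [N HN] := stopped_count ab smap_surj FN OI T_types M_at K_self_similar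
  m01 m_le k01 g0 g_edge.
have [c1 [c2 [_ c20 Hc]]] := stopped_bounds Omega ab T i0 m01 m_le g0.
pose W := weight Omega F a b T i0 g.
have W0 : 0 < W w0 by apply: weight_gt0.
have mass0 : 0 < mass t h w0.
  by rewrite /mass w0i mulr_gt0// powR_gt0// (vratio_gt0 ab (F := F)); case: w0R.
have [H H0 hH] := finite_bound h 0.
(* Bounds the mass of the stopped nodes that meet a ball, in units of its radius to the power [t];
   the successor keeps it positive. *)
pose C := N.+1%:R * (c2 `^ t * H).
have C0 : 0 < C by rewrite !mulr_gt0 ?powR_gt0.
(* Half of the bound obtained for balls; the other half pays for enlarging the covering sets to
   balls. *)
pose e := mass t h w0 / C / 2; have e0 : 0 < e by rewrite !divr_gt0.
suff : (e%:E <= hausdorff_measure t (\bigcup_i K i))%E.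
  by move=> He; rewrite gt_eqF// (lt_le_trans _ He)// lte_fin.
(* At this scale all radii can be kept below [W w0], so that branches start above the threshold. *)
have Wd0 : 0 < W w0 / 2 by rewrite divr_gt0.
apply: (@le_trans _ _ (hausdorff_content t (W w0 / 2) (\bigcup_i K i))); last first.
  by apply: ereal_sup_ubound; exists (W w0 / 2).
apply: le_ereal_inf_tmp => _ [U [Ud UK] <-].
pose i := vini w0; pose B := [set l | U l `&` K i !=set0].
have /choice[x xP] : forall l, exists x, B l -> (U l `&` K i) x.
  move=> l; have [[x Ux]|nB] := pselect (B l); first by exists x.
  have [[x _] _] := proj1 K_self_similar i.
  by exists x.
have /choice[r rP] : forall l, exists r, B l ->
    [/\ 0 < r, r < W w0, forall y : M, U l y -> mdist (x l) y < r &
    ((r `^ t)%:E <= diam_pow t (U l) + (e * 2^-1 ^+ l.+1)%:E)%E].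
  move=> l; have [Bl|nB] := pselect (B l); last by exists 0.
  have [Ux _] := xP l Bl; have Un : U l !=set0 by exists (x l).
  have := Ud l; have := diam_ge0 Un; have := fun y : M => @diam_ge _ _ (U l) (x l) y Ux.
  rewrite /diam_pow; case: eqP => [U0|_]; first by rewrite U0 in Ux.
  case: (diam (U l)) => [D||] //; rewrite ?lee_fin => UD D0 DW.
  have DW' : D < W w0 by rewrite (le_lt_trans DW)// ltr_pdivrMr// ltr_pMr// ltr1n.
  have el : 0 < e * 2^-1 ^+ l.+1 by rewrite mulr_gt0// exprn_gt0.
  have [r /andP[Dr rW] rD] := small_radius t0 D0 DW' el.
  exists r => _; split=> //; first exact: le_lt_trans Dr.
    by move=> y /UD; rewrite lee_fin => /le_lt_trans; apply.
have [Kn cK] := proj1 K_self_similar i.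
have [l Bl||D' D'B KD] := compact_cover_nonempty Kn cK (D := B)
    (f := fun l => [set y : M | mdist (x l) y < r l]).
- apply/open_mdist => y /= yr; exists (r l - mdist (x l) y); first by rewrite subr_gt0.
  by move=> u yu; rewrite (le_lt_trans (metric_triangle _ y _))// -ltrBrDl.
- move=> y Ky; have [l _ Uy] : (\bigcup_l U l) y by apply: UK; exists i.
  have Bl : B l by exists y.
  by exists l => //=; have [_ _ ->] := rP l Bl.
have {}D'B l : l \in D' -> B l by move=> /D'B; rewrite inE.
(* By depth [j] every branch has been stopped, for each of the finitely many radii. *)
have [j Hj] : exists j, forall l, l \in D' -> k ^+ j * W w0 < r l.
  have [r0 r00 Hr] : exists2 r0, 0 < r0 & forall l, l \in D' -> r0 <= r l.
    have : forall l, l \in enum_fset D' -> 0 < r l.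
      by move=> l /D'B/rP[].
    have: forall l, (l \in D') = (l \in enum_fset D') by [].
    move: (enum_fset D') => s sE sr.
    suff [r0 r00 Hr] : exists2 r0, 0 < r0 & forall l, l \in s -> r0 <= r l.
      by exists r0 => // l; rewrite sE; exact: Hr.
    elim: s sr {sE} => [|l s IH] sr; first by exists 1.
    have [|r0 r00 Hr] := IH; first by move=> l' l's; apply: sr; rewrite inE l's orbT.
    exists (Num.min r0 (r l)); first by rewrite lt_min r00 sr// mem_head.
    by move=> l'; rewrite inE ge_min => /orP[/eqP ->|/Hr ->//]; rewrite lexx orbT.
  have : k ^+ j @[j --> \oo] --> (0 : R) by apply: cvg_expr; rewrite gtr0_norm.
  move=> /cvgrPdist_lt/(_ _ (divr_gt0 r00 W0))[j _ /(_ j (leqnn j))].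
  rewrite /= sub0r normrN gtr0_norm ?exprn_gt0// => kj.
  exists j => l /Hr; apply: lt_le_trans.
  by rewrite -ltr_pdivlMr.
pose st l z := stopped Omega F a b T i0 g w0 (r l) z /\
  exists2 y : M, vcell K (descend w0 z) y & mdist (x l) y < r l.
pose Zl l := undup [seq z <- flatten [seq nodes j' w0 | j' <- iota 0 j.+1] | `[< st l z >]].
pose Z := flatten [seq Zl l | l <- D'].
(* The cell of a node of depth [j] meets some ball of the cover; the ancestor stopped at the radius
   of that ball has a larger cell, which meets it too. *)
have massZ : mass t h w0 <= \sum_(z <- Z) mass t h (descend w0 z).
  apply: (mass_cut (j := j)) => // z nz sz.
  have zR := descend_reduced w0R nz; have [zF _] := zR.
  have [[y' Ky'] _] := proj1 K_self_similar (vter (descend w0 z)).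
  have zy : vcell K (descend w0 z) (vmap (descend w0 z) y') by exists y'.
  move: (vmap _ _) zy => y zy.
  have Ky : K i y by have := vcell_attractor FN K_self_similar zF zy; rewrite vini_descend.
  have [l /= lD xy] := KD y Ky; have [rl0 rlW _ _] := rP l (D'B l lD).
  have Wz : W (descend w0 z) <= r l.
    apply/ltW; apply: le_lt_trans (Hj l lD).
    by have := weight_descend ab k01 g_edge w0R nz; rewrite sz.
  have [y1 y1z y1S] := stopped_prefix nz Wz rlW.
  exists y1 => //; apply/flatten_mapP; exists l => //.
  rewrite mem_undup mem_filter; apply/andP; split.
    apply/asboolP; split=> //; exists y => //.
    move: y1z zy nz => /prefixP[y2 ->]; rewrite is_node_cat descend_cat => zy /andP[_ ny2].
    exact: (vcell_descend FN K_self_similar ny2).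
  have [n1 _ _] := y1S; apply/flatten_mapP; exists (size y1).
    by rewrite mem_iota /= add0n ltnS -sz; exact: size_prefix.
  by rewrite mem_nodes n1 eqxx.
have mass_l l : l \in D' -> \sum_(z <- Zl l) mass t h (descend w0 z) <= C * r l `^ t.
  move=> lD; have [rl0 _ _ _] := rP l (D'B l lD); have [_ Kxl] := xP l (D'B l lD).
  have ZlS z : z \in Zl l -> st l z.
    by rewrite mem_undup mem_filter => /andP[/asboolP].
  apply: (@le_trans _ _ (\sum_(z <- Zl l) c2 `^ t * H * r l `^ t)).
    rewrite big_seq [leRHS]big_seq; apply: ler_sum => z /ZlS[zS _].
    have /andP[_ vz] := Hc _ _ _ w0R zS; have [nz _ _] := zS.
    have [zF _] := descend_reduced w0R nz.
    rewrite mulrAC -powRM ?(ltW c20) ?(ltW rl0)//; apply: ler_pM => //.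
    - exact: powR_ge0.
    - rewrite ge0_ler_powR// nnegrE; first exact/ltW/(vratio_gt0 ab zF).
      by rewrite mulr_ge0// ltW.
    - exact/ltW/hH.
  rewrite big_const_seq count_predT iter_addr_0 -[leLHS]mulr_natl /C -[leRHS]mulrA.
  rewrite ler_wpM2r ?mulr_ge0 ?powR_ge0 ?(ltW H0)// ler_nat.
  apply: leqW; apply: (HN w0 (x l) (r l)) => //; exact: undup_uniq.
have : mass t h w0 / C <= \sum_(l <- D') r l `^ t.
  rewrite ler_pdivrMr// mulrC mulr_sumr; apply: (le_trans massZ).
  rewrite big_flatten big_map /= big_seq [leRHS]big_seq.
  by apply: ler_sum => l lD; exact: mass_l.
have -> : mass t h w0 / C = e + e by rewrite -splitr.
have half : (\sum_(l <- D') (e * 2^-1 ^+ l.+1)%:E <= e%:E)%E.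
  apply: (le_trans (lee_sum_subseq _ _)).
    by move=> l; rewrite lee_fin mulr_ge0 ?exprn_ge0// ltW.
  apply: lime_le.
    by apply: is_cvg_nneseries => l _ _; rewrite lee_fin mulr_ge0 ?exprn_ge0// ltW.
  apply: nearW => l; rewrite sumEFin lee_fin -mulr_sumr ger_pMr//.
  exact/ltW/sum_half_lt1.
rewrite -lee_fin EFinD -sumEFin => He.
have : (e%:E + e%:E <= \sum_(0 <= l <oo) diam_pow t (U l) + e%:E)%E.
  apply: (le_trans He); apply: (@le_trans _ _ (\sum_(l <- D')
      (diam_pow t (U l) + (e * 2^-1 ^+ l.+1)%:E))%E).
    rewrite big_seq [leRHS]big_seq; apply: lee_sum => l lD.
    by have [_ _ _] := rP l (D'B l lD).
  rewrite big_split /=; apply: leeD => //.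
  by apply: lee_sum_subseq => l; exact: diam_pow_ge0.
by rewrite leeD2rE.
Qed.
End Mass.

Theorem theorem1p6 (R : realType) (M : metricType R)
  (n : nat) (n_gt0 : (0 < n)%N)
  (atlas : set (chart M R n)) (g : chart M R n -> 'rV[R]_n -> 'M[R]_n)
  (M_riemannian : riemannian_manifold atlas g)
  (M_orientable : orientable atlas)
  (M_complete : complete_metric M)
  (M_euclidean : locally_euclidean M)
  (d : Order.disp_t) (G : gifs M d)
  (K : 'I_(nvert G) -> set M) (K_self_similar : self_similar_family K)
  (Omega : 'I_(nvert G) -> set M) (F : nat -> {fset dpath G})
  (G_gftc : gftc_for Omega F)
  (q : nat) (T : 'I_q -> set (vertex G))
  (T_types : enumerates_types Omega F T)
  (A : R -> 'M[R]_q)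
  (A_incidence : forall alpha, weighted_incidence Omega F T alpha (A alpha)) :
  exists alpha : R,
    [/\ spectral_radius (A alpha) = 1,
        forall beta : R, spectral_radius (A beta) = 1 -> beta = alpha &
        hausdorff_dim (\bigcup_i K i) = alpha%:E].
Proof.
have [_ M_atlas _ _] := M_riemannian; have [OI FN _] := G_gftc.
have M_connected := riemannian_connected M_riemannian.
pose v0 : 'I_(nvert G) := Ordinal (nvert_gt0 G).
have [[x0 Kx0] _] := proj1 K_self_similar v0.
have [b ba] := atlas_two_points n_gt0 M_atlas x0.
have [m M_at] := euclidean_at_constant M_connected M_euclidean x0.
have smap_surj e y : exists x, smap (g := G) e x = y.
  have /andP[e0 _] := ratio_bounds e.
  exact: (similitude_surjective M_connected M_euclidean M_complete e0 (smap_similitude e)).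
(* [K] is nonempty, so there is a reduced vertex and hence a type. *)
have [i0 _] : exists i0 : 'I_q, True.
  have [w [wR _ _ _]] := attractor_reduced FN K_self_similar 0 Kx0.
  have : (ntype Omega F @` reduced_vertex F) (ntype Omega F w) by exists w.
  by rewrite -(proj2 T_types) => -[i _ _]; exists i.
have [mr mr01 mr_le] := path_ratio_lower FN i0 T_types A_incidence.
have [h [k [k01 h0 h_edge]]] := edge_potential ba FN i0 T_types A_incidence.
pose ti := type_index Omega F T i0.
have /choice[r rP] : forall i, exists w, reduced_vertex F w /\ ti w = i.
  by move=> i; have [w wR wi] := type_index_repr i0 T_types i; exists w.
(* [pressure_zero] takes the entries as explicit sums of powers: one list of ratios per pair of
   types, read off a representative. *)
pose P i j := [seq path_ratio p | p <- labels F (r i) & ti (child (r i) p) == j].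
have PP i j t : t \in P i j -> exists p, [/\ p \in labels F (r i),
    ti (child (r i) p) = j & t = path_ratio p].
  by move=> /mapP[p]; rewrite mem_filter => /andP[/eqP pj pl ->]; exists p.
have [s i j|i j t|i j t|i|alpha [a0 ra ua Pa Qa]] :=
    @pressure_zero R q P A mr k h i0 _ mr01 _ k01 h0.
- have [rR ri] := rP i; rewrite -{1}ri.
  by rewrite (incidenceE FN i0 T_types A_incidence)// big_map big_filter.
- by have [rR _] := rP i; move=> /PP[p [pl _ ->]]; rewrite path_ratio_le1 (mr_le _ _ rR).
- have [rR ri] := rP i; move=> /PP[p [pl <- ->]].
  by rewrite -[in leRHS]ri; exact: h_edge.
- have [rR _] := rP i; have [p pe] := reduced_child FN rR.
  exists (ti (child (r i) p)); rewrite -size_eq0 size_map -lt0n -has_predT.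
  by apply/hasP; exists p => //; rewrite mem_filter eqxx; apply/mem_labels.
exists alpha; split=> //; apply/eqP; rewrite eq_le; apply/andP; split.
  (* The measure at [alpha] itself does not vanish, so the upper bound goes through [alpha + e]. *)
  apply/lee_addgt0Pr => e e0; rewrite -EFinD; apply: ereal_inf_lbound.
  have ae0 : 0 <= alpha + e by rewrite addr_ge0// ltW.
  exists (alpha + e) => //; split=> //.
  apply: (upper_dimension ba FN i0 T_types K_self_similar A_incidence ae0).
  by apply: Qa; rewrite ltrDl.
apply: le_ereal_inf_tmp => _ [t [t0 Ht] <-]; rewrite lee_fin leNgt; apply/negP => ta.
have := lower_dimension ba smap_surj FN OI i0 T_types M_at K_self_similar A_incidence
  t0 (Pa _ (ltW ta)).
by rewrite Ht eqxx.
Qed.
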